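(* Let $k$ be a field and let $G$ be a finite group whose order is invertible in $k$. Let $\Lambda$ be a $k$-algebra with an action of $G$ by algebra automorphisms. There is an isomorphism of algebras $$HH_{\{1\}}^*(\Lambda[G])\simeq HH^*(\Lambda)^G.$$
   Context: $HH^*(\Lambda)$ is the Hochschild cohomology of the $k$-algebra $\Lambda$ with coefficients in $\Lambda$, a graded algebra under the cup product. It is computed by the standard complex $C^n(\Lambda)=\mathrm{Hom}_k(\Lambda^{\otimes n},\Lambda)$ with the usual Hochschild coboundary, and the cup product is $(\psi\smile\varphi)(a_{n+m}\otimes\cdots\otimes a_1)=\psi(a_{n+m}\otimes\cdots\otimes a_{n+1})\varphi(a_n\otimes\cdots\otimes a_1)$ for $\psi,\varphi$ of degrees $m,n$. The group $G$ acts on cochains by $(s.\varphi)(a_n\otimes\cdots\otimes a_1)=s\varphi(s^{-1}a_n\otimes\cdots\otimes s^{-1}a_1)$, inducing an action on $HH^*(\Lambda)$ by algebra automorphisms; $HH^*(\Lambda)^G$ is the subalgebra of invariants. The skew group algebra is $\Lambda[G]=\Lambda\otimes kG$ as a vector space, with product $(a\otimes s)(b\otimes t)=as(b)\otimes st$. It is $G$-graded with $\Lambda[G]^s=\Lambda\otimes s$. For a $G$-graded algebra $B=\bigoplus_{s\in G}B^s$, $HH^*_{\{1\}}(B)$ (the component for the trivial conjugacy class $\{1\}$) is the cohomology of the sub differential graded algebra of the standard complex $C^\bullet(B)$ consisting of the cochains $\varphi$ with $\varphi(B^{s_n}\otimes\cdots\otimes B^{s_1})\subset B^{s_n\cdots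 s_1}$ for all $s_1,\dots,s_n\in G$ (for $n=0$: $\varphi\in B^1$). *)

(* Defs.v *)
From HB Require Import structures.
From mathcomp Require Import all_boot all_order all_algebra all_fingroup.
From mathcomp Require Import boolp functions.

Set Implicit Arguments.
Unset Strict Implicit.
Unset Printing Implicit Defensive.

Import GRing.Theory.
Local Open Scope ring_scope.

(* Decides equalities of signed sums of pairwise distinct atoms in a zmodType. *)
Local Ltac abel_step :=
  match goal with
  | |- - ?x + ?r = 0 => do ?[rewrite (addrCA _ x)]; rewrite ?addNKr
  | |- ?x + ?r = 0 => do ?[rewrite (addrCA _ (- x))]; rewrite ?addKr
  end.
Local Ltac abel :=
  apply/eqP; rewrite -subr_eq0 -[eqbLHS]addr0; apply/eqP;
  rewrite ?(opprD, opprK, oppr0, add0r) -?addrA ?add0r;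
  do ?abel_step; reflexivity.

Section Operations.
Variables (k : fieldType) (A : algType k).
Implicit Types (f g h : seq A -> A) (s t : seq A) (n i : nat).

(* Below @ denotes the tensor product over k. A cochain of degree n, a linear  *)
(* map on the n-th tensor power of A, is an n-linear map. An element of the    *)
(* total complex, the direct sum over n, is encoded as one function on lists:  *)
(* its value at [:: a_n; ...; a_1] is that of its degree n component at        *)
(* a_n @ ... @ a_1, and it vanishes on all long enough lists.                  *)
Definition multilinear f := forall (a : k) s t (x y : A),
  f (s ++ (a *: x + y) :: t) = a *: f (s ++ x :: t) + f (s ++ y :: t).

Definition bounded f := exists N, forall s, (N <= size s)%N -> f s = 0.

Definition is_cochain : {pred seq A -> A} :=
  fun f => `[< multilinear f /\ bounded f >].

Definition cup f g : seq A -> A := fun s =>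
  \sum_(i < (size s).+1) f (take i s) * g (drop i s).

Definition cup1 : seq A -> A := fun s => if s is [::] then 1 else 0.

Definition contract i s : seq A :=
  take i s ++ (s`_i * s`_i.+1) :: drop i.+2 s.

Definition hdiff f : seq A -> A := fun s =>
  if s is x :: t then
    x * f t + \sum_(i < size t) (-1) ^+ i.+1 * f (contract i s)
      + (-1) ^+ (size s) * (f (belast x t) * last x t)
  else 0.

Definition hcomp n f : seq A -> A := fun s => if size s == n then f s else 0.

(* The sign involution, (-1) ^ n in degree n.                                  *)
Definition sgnc f : seq A -> A := fun s => (-1) ^+ size s * f s.

(* Only for proofs: hdiff f = idc * f - (sgnc f) * idc - innd f, where * is    *)
(* the cup product and idc is the identity map of A in degree 1.               *)
Definition idc : seq A -> A := fun s => if s is [:: x] then x else 0.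
Definition peel (x : A) f : seq A -> A := fun s => f (x :: s).
Fixpoint innd f s : A :=
  if s is x :: t then
    if t is y :: u then f ((x * y) :: u) - innd (peel x f) t else 0
  else 0.

Lemma fctD f g s : (f + g) s = f s + g s. Proof. by []. Qed.
Lemma fctN f s : (- f) s = - f s. Proof. by []. Qed.
Lemma fctZ (a : k) f s : (a *: f) s = a *: f s. Proof. by []. Qed.

Lemma cup_nil f g : cup f g [::] = f [::] * g [::].
Proof. by rewrite /cup big_ord1. Qed.

Lemma cup_cons f g x s :
  cup f g (x :: s) = f [::] * g (x :: s) + cup (peel x f) g s.
Proof. by rewrite /cup big_ord_recl. Qed.

Lemma cupDl f g h : cup (f + g) h = cup f h + cup g h.
Proof.
by apply/funext => s; rewrite fctD /cup -big_split; apply: eq_bigr => i _ /=; rewrite mulrDl.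
Qed.

Lemma cupDr f g h : cup f (g + h) = cup f g + cup f h.
Proof.
by apply/funext => s; rewrite fctD /cup -big_split; apply: eq_bigr => i _ /=; rewrite mulrDr.
Qed.

Lemma cupZl (a : k) f g : cup (a *: f) g = a *: cup f g.
Proof.
apply/funext => s; rewrite fctZ /cup scaler_sumr.
by apply: eq_bigr => i _ /=; rewrite -scalerAl.
Qed.

Lemma cupZr (a : k) f g : cup f (a *: g) = a *: cup f g.
Proof.
apply/funext => s; rewrite fctZ /cup scaler_sumr.
by apply: eq_bigr => i _ /=; rewrite -scalerAr.
Qed.

Lemma cupNl f g : cup (- f) g = - cup f g.
Proof. by rewrite -!scaleN1r cupZl. Qed.

Lemma cupNr f g : cup f (- g) = - cup f g.
Proof. by rewrite -!scaleN1r cupZr. Qed.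

Lemma cup1l : left_id cup1 cup.
Proof.
move=> f; apply/funext => s; rewrite /cup big_ord_recl take0 drop0 mul1r.
rewrite big1 ?addr0 // => i _ /=.
by case: s i => [[]|x s i] //=; rewrite mul0r.
Qed.

Lemma cup1r : right_id cup1 cup.
Proof.
move=> f; apply/funext => s; rewrite /cup big_ord_recr /= take_size drop_size.
rewrite mulr1 big1 ?add0r // => i _ /=.
case E: (drop i s) => [|x u]; last by rewrite mulr0.
by have := size_drop i s; rewrite E /= => /esym/eqP; rewrite subn_eq0 leqNgt ltn_ord.
Qed.

Lemma cupA : associative cup.
Proof.
move=> f g h; apply/funext => s; elim: s f g => [|x s IH] f g.
  by rewrite !cup_nil mulrA.
rewrite 3!cup_cons cup_nil mulrDr mulrA -addrA; congr (_ + _).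
have -> : peel x (cup f g) = (fun s => f [::] * peel x g s) + cup (peel x f) g.
  by apply/funext => t; rewrite /peel cup_cons.
rewrite cupDl IH fctD; congr (_ + _).
by rewrite /cup mulr_sumr; apply: eq_bigr => i _; rewrite mulrA.
Qed.

Lemma shiftD x f g : peel x (f + g) = peel x f + peel x g.
Proof. by []. Qed.

Lemma shiftZ x (a : k) f : peel x (a *: f) = a *: peel x f.
Proof. by []. Qed.

Lemma inndD f g s : innd (f + g) s = innd f s + innd g s.
Proof.
elim: s f g => [|x [|y t] IH] f g; rewrite ?addr0 //=.
by rewrite -/(innd _ (y :: t)) shiftD IH opprD addrACA.
Qed.

Lemma inndZ (a : k) f s : innd (a *: f) s = a *: innd f s.
Proof.
elim: s f => [|x [|y t] IH] f; rewrite ?scaler0 //=.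
by rewrite -/(innd _ (y :: t)) shiftZ IH scalerBr.
Qed.

Lemma inndN f s : innd (- f) s = - innd f s.
Proof. by rewrite -scaleN1r inndZ scaleN1r. Qed.

(* z * f for a constant z acts pointwise *)
Lemma innd_mull (z : A) f s : innd (fun u => z * f u) s = z * innd f s.
Proof.
elim: s f => [|x [|y t] IH] f; rewrite ?mulr0 //=.
by rewrite -/(innd _ (y :: t)) -/(innd _ (y :: t)) IH mulrBr.
Qed.

Lemma eq_innd_ne f g s : (forall x t, f (x :: t) = g (x :: t)) ->
  innd f s = innd g s.
Proof.
elim: s f g => [|x [|y t] IH] f g //= E; rewrite E; congr (_ - _).
by apply: IH => z u; apply: E.
Qed.

Lemma sgnc_cons x f : peel x (sgnc f) = - sgnc (peel x f).
Proof. by apply/funext => s; rewrite /peel /sgnc /= exprS mulN1r mulNr. Qed.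

Lemma innd_cup f g s :
  innd (cup f g) s = cup (innd f) g s + cup (sgnc f) (innd g) s.
Proof.
elim: s f => [|x s IH] f; first by rewrite !cup_nil mul0r mulr0 addr0.
case: s IH => [|y t] IH.
  by rewrite !cup_cons !cup_nil /= !mul0r !mulr0 !addr0.
have E1 : innd (cup f g) (x :: y :: t) =
   cup f g (x * y :: t) - innd (peel x (cup f g)) (y :: t) by [].
have E2 : peel x (cup f g) = (fun u => f [::] * peel x g u) + cup (peel x f) g.
  by apply/funext => u; rewrite /peel cup_cons.
rewrite E1 E2 inndD innd_mull IH !(cup_cons _ _ x) (cup_cons f).
rewrite sgnc_cons cupNl fctN.
have -> : cup (peel x (innd f)) g (y :: t) =
  cup (peel (x * y) f) g t - cup (innd (peel x f)) g (y :: t).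
  rewrite !cup_cons /= !mul0r !add0r.
  rewrite -[RHS]/((cup (peel (x * y) f) g - cup (peel y (innd (peel x f))) g) t).
  by rewrite -cupNl -cupDl.
have -> : sgnc f [::] = f [::] by rewrite /sgnc expr0 mul1r.
have -> : innd g (x :: y :: t) = g (x * y :: t) - innd (peel x g) (y :: t) by [].
rewrite [innd f [::]]/= mul0r add0r mulrBr.
by abel.
Qed.

Lemma innd_innd f : innd (innd f) = 0.
Proof.
apply/funext => s.
elim: s f => [|x [|y [|z t]] IH] f //; first by rewrite /= subrr.
have E (F : seq A -> A) u v w :
  innd F [:: u, v & w] = F (u * v :: w) - innd (peel u F) (v :: w) by [].
rewrite (E (innd f)) (E f).
have -> : innd (peel x (innd f)) [:: y, z & t] =
  innd ((fun u => if u is y' :: v then f (x * y' :: v) else 0)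
         - innd (peel x f)) [:: y, z & t].
  by apply: eq_innd_ne => y' v.
rewrite inndD inndN IH oppr0 addr0 E.
by rewrite mulrA /peel subrr.
Qed.

Lemma sgncK : involutive sgnc.
Proof. by move=> f; apply/funext => s; rewrite /sgnc mulrA -expr2 sqrr_sign mul1r. Qed.

Lemma sgncD f g : sgnc (f + g) = sgnc f + sgnc g.
Proof. by apply/funext => s; rewrite /sgnc mulrDr. Qed.

Lemma sgncZ (a : k) f : sgnc (a *: f) = a *: sgnc f.
Proof. by apply/funext => s; rewrite /sgnc /= -scalerAr. Qed.

Lemma sgncN f : sgnc (- f) = - sgnc f.
Proof. by rewrite -!scaleN1r sgncZ. Qed.

Lemma sgnc_cup f g : sgnc (cup f g) = cup (sgnc f) (sgnc g).
Proof.
apply/funext => s; rewrite /sgnc /cup mulr_sumr; apply: eq_bigr => i _.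
have {1}-> : size s = (size (take i s) + size (drop i s))%N.
  by rewrite -size_cat cat_take_drop.
rewrite exprD -!mulrA; congr (_ * _); rewrite !mulrA; congr (_ * _).
by apply/esym; apply: commr_sign.
Qed.

Lemma sgnc_innd f : sgnc (innd f) = - innd (sgnc f).
Proof.
apply/funext => s; rewrite fctN.
elim: s f => [|x [|y t] IH] f; rewrite /sgnc ?mulr0 ?oppr0 //.
have E (F : seq A -> A) u v w :
  innd F [:: u, v & w] = F (u * v :: w) - innd (peel u F) (v :: w) by [].
rewrite !E -/(sgnc f) sgnc_cons inndN -IH /sgnc /= !exprS !mulN1r mulrBr.
by rewrite !mulNr; abel.
Qed.

Lemma sgnc_idc : sgnc idc = - idc.
Proof.
apply/funext => s; rewrite /sgnc fctN.
by case: s => [|x [|y t]] /=; rewrite ?mulr0 ?oppr0 // expr1 mulN1r.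
Qed.

Lemma innd_idc : innd idc = cup idc idc.
Proof.
apply/funext => -[|x [|y [|z t]]].
- by rewrite cup_nil mul0r.
- by rewrite cup_cons cup_nil /peel /= mul0r mulr0 addr0.
- by rewrite !cup_cons cup_nil /peel /= !(mul0r, mulr0, addr0, add0r, subr0).
have innd_cons2 (F : seq A -> A) u v w :
  innd F [:: u, v & w] = F (u * v :: w) - innd (peel u F) (v :: w) by [].
rewrite !innd_cons2 (_ : peel y (peel x idc) = 0) //.
have -> : innd 0 (z :: t) = 0 by rewrite -(scale0r (0 : seq A -> A)) inndZ scale0r.
rewrite !subr0 !cup_cons /= !(mul0r, mulr0, add0r) /cup big1 // => i _.
by rewrite /peel /= mul0r.
Qed.

Lemma idc_cup f x t : cup idc f (x :: t) = x * f t.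
Proof.
rewrite cup_cons mul0r add0r /cup big_ord_recl take0 drop0 big1 ?addr0 // => i _.
by case: t i => [[]|y t i] //=; rewrite /peel /= mul0r.
Qed.

Lemma cup_idc f x t : cup f idc (x :: t) = f (belast x t) * last x t.
Proof.
rewrite lastI /cup size_rcons 2!big_ord_recr /=.
rewrite [take (size _).+1 _]take_oversize ?size_rcons //.
rewrite [drop (size _).+1 _]drop_oversize ?size_rcons // mulr0 addr0.
rewrite -cats1 take_size_cat // drop_size_cat // big1 ?add0r // => i _.
rewrite drop_cat (ltn_ord i).
case E: (drop i (belast x t)) => [|y u].
  have := size_drop i (belast x t); rewrite E /= => /esym/eqP.
  by rewrite subn_eq0 leqNgt ltn_ord.
by case: u {E} => [|z u]; rewrite /= mulr0.
Qed.

Lemma inndE f x t :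
  innd f (x :: t) = \sum_(i < size t) (-1) ^+ i * f (contract i (x :: t)).
Proof.
elim: t x f => [|y t IH] x f; first by rewrite big_ord0.
rewrite -[LHS]/(f (x * y :: t) - innd (peel x f) (y :: t)) IH big_ord_recl.
rewrite expr0 mul1r /contract /= drop0; congr (_ + _).
rewrite -sumrN; apply: eq_bigr => i _.
by rewrite /bump add1n exprS mulN1r mulNr.
Qed.

Lemma hdiffE f : hdiff f = cup idc f - cup (sgnc f) idc - innd f.
Proof.
apply/funext => -[|x t].
  rewrite fctD [X in X + _]/GRing.add /= /GRing.opp /=.
  by rewrite !cup_nil mul0r mulr0 !subr0.
rewrite -[RHS]/(cup idc f (x :: t) - cup (sgnc f) idc (x :: t) - innd f (x :: t)).
rewrite idc_cup cup_idc inndE /= addrAC; congr (_ + _ + _).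
  by rewrite /sgnc size_belast exprS mulN1r mulNr mulrA.
by rewrite -sumrN; apply: eq_bigr => i _; rewrite exprS mulN1r mulNr.
Qed.

Lemma cupBl f g h : cup (f - g) h = cup f h - cup g h.
Proof. by rewrite cupDl cupNl. Qed.

Lemma cupBr f g h : cup f (g - h) = cup f g - cup f h.
Proof. by rewrite cupDr cupNr. Qed.

Lemma innd_fD f g : innd (f + g) = innd f + innd g.
Proof. by apply/funext => s; rewrite inndD. Qed.
Lemma innd_fN f : innd (- f) = - innd f.
Proof. by apply/funext => s; rewrite inndN. Qed.
Lemma innd_fZ (a : k) f : innd (a *: f) = a *: innd f.
Proof. by apply/funext => s; rewrite inndZ. Qed.
Lemma innd_fcup f g : innd (cup f g) = cup (innd f) g + cup (sgnc f) (innd g).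
Proof. by apply/funext => s; rewrite innd_cup. Qed.

Lemma hdiffD f g : hdiff (f + g) = hdiff f + hdiff g.
Proof.
by rewrite !hdiffE sgncD cupDl cupDr innd_fD; abel.
Qed.

Lemma hdiffZ (a : k) f : hdiff (a *: f) = a *: hdiff f.
Proof. by rewrite !hdiffE sgncZ cupZl cupZr innd_fZ !scalerBr. Qed.

Lemma hdiff_cup f g : hdiff (cup f g) = cup (hdiff f) g + cup (sgnc f) (hdiff g).
Proof.
rewrite !hdiffE innd_fcup sgnc_cup !cupBl !cupBr !cupA opprD !addrA.
by abel.
Qed.

Lemma sgnc_hdiff f : sgnc (hdiff f) = - hdiff (sgnc f).
Proof.
rewrite !hdiffE !sgncD !sgncN !sgnc_cup sgnc_innd sgnc_idc sgncK.
by rewrite cupNl cupNr !opprK !opprD !opprK.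
Qed.

Lemma hdiff_hdiff f : hdiff (hdiff f) = 0.
Proof.
rewrite (hdiffE (hdiff f)) sgnc_hdiff (hdiffE f) (hdiffE (sgnc f)).
rewrite !cupNl !opprK !cupBr !cupBl !innd_fD !innd_fN !innd_fcup innd_innd.
rewrite !sgncK innd_idc sgnc_idc !cupNl !cupA.
by abel.
Qed.

Lemma peel_multilinear x f : multilinear f -> multilinear (peel x f).
Proof. by move=> mf a s t u v; rewrite /peel -!cat_cons mf. Qed.

Lemma peel_lin (a : k) x y f : multilinear f ->
  peel (a *: x + y) f = a *: peel x f + peel y f.
Proof. by move=> mf; apply/funext => s; exact: (mf a [::]). Qed.

Lemma cup_multilinear f g :
  multilinear f -> multilinear g -> multilinear (cup f g).
Proof.
move=> mf mg a s; elim: s f mf => [|w s IH] f mf t x y /=.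
  rewrite !cup_cons peel_lin // cupDl cupZl fctD fctZ (mg a [::]) /=.
  by rewrite mulrDr -scalerAr scalerDr addrACA.
rewrite !cup_cons -!cat_cons mg IH; last exact: peel_multilinear.
by rewrite /= mulrDr -scalerAr scalerDr addrACA.
Qed.

Lemma innd_multilinear f : multilinear f -> multilinear (innd f).
Proof.
have innd_cons2 (F : seq A -> A) u v w :
  innd F [:: u, v & w] = F (u * v :: w) - innd (peel u F) (v :: w) by [].
move=> mf a s; elim: s f mf => [|w [|w' s] IH] f mf t x y.
- case: t => [|z t]; first by rewrite /= scaler0 addr0.
  rewrite !cat0s !innd_cons2 peel_lin // inndD inndZ mulrDl -scalerAl (mf a [::]).
  by rewrite opprD scalerBr addrACA.
- rewrite !cat1s !innd_cons2 (IH _ (peel_multilinear _ mf)) !cat0s.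
  by rewrite mulrDr -scalerAr (mf a [::]) opprD scalerBr addrACA.
rewrite !cat_cons !innd_cons2 -!cat_cons (IH _ (peel_multilinear _ mf)) mf.
by rewrite opprD scalerBr addrACA.
Qed.

Lemma sgnc_multilinear f : multilinear f -> multilinear (sgnc f).
Proof.
by move=> mf a s t x y; rewrite /sgnc mf !size_cat /= mulrDr -scalerAr.
Qed.

Lemma hcomp_multilinear n f : multilinear f -> multilinear (hcomp n f).
Proof.
move=> mf a s t x y; rewrite /hcomp !size_cat /=.
by case: eqP => _; rewrite ?mf // scaler0 addr0.
Qed.

Lemma idc_multilinear : multilinear idc.
Proof. by move=> a [|w [|w' s]] [|z t] x y /=; rewrite ?scaler0 ?addr0. Qed.

Lemma cup1_multilinear : multilinear cup1.
Proof. by move=> a [|w s] t x y /=; rewrite scaler0 addr0. Qed.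

Lemma size_contract i x t : (i < size t)%N -> size (contract i (x :: t)) = size t.
Proof.
move=> lti; rewrite size_cat size_takel /=; last by rewrite leqW // ltnW.
by rewrite size_drop -subSn // subSS subnKC // ltnW.
Qed.

Lemma cup_bounded f g : bounded f -> bounded g -> bounded (cup f g).
Proof.
move=> [N fN] [M gM]; exists (N + M)%N => s les; rewrite /cup big1 // => i _.
have lei : (i <= size s)%N by rewrite -ltnS.
have [ltiN|leNi] := ltnP i N; last by rewrite fN ?mul0r // size_takel.
by rewrite gM ?mulr0 // size_drop leq_subRL // (leq_trans _ les) // leq_add2r ltnW.
Qed.

Lemma innd_bounded f : bounded f -> bounded (innd f).
Proof.
move=> [N fN]; exists N.+1 => -[|x t] // leN; rewrite inndE big1 // => i _.
by rewrite fN ?mulr0 // size_contract.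
Qed.

Lemma is_cochainP f : reflect (multilinear f /\ bounded f) (f \in is_cochain).
Proof. exact: asboolP. Qed.

Lemma is_cochain_cup f g :
  f \in is_cochain -> g \in is_cochain -> cup f g \in is_cochain.
Proof.
move=> /is_cochainP[mf bf] /is_cochainP[mg bg]; apply/is_cochainP.
by split; [exact: cup_multilinear|exact: cup_bounded].
Qed.

Lemma is_cochain_cup1 : cup1 \in is_cochain.
Proof.
by apply/is_cochainP; split; [exact: cup1_multilinear|exists 1%N => -[]].
Qed.

Lemma is_cochain_submod : submod_closed is_cochain.
Proof.
split=> [|a f g /is_cochainP[mf [N fN]] /is_cochainP[mg [M gM]]].
  apply/is_cochainP; split=> [a s t x y|]; last by exists 0%N.
  by rewrite scaler0 addr0.
apply/is_cochainP; split=> [b s t x y|].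
  rewrite !fctD !fctZ mf mg !scalerDr !scalerA mulrC.
  by rewrite -!scalerA addrACA.
exists (maxn N M) => s; rewrite geq_max => /andP[leN leM].
by rewrite fctD fctZ fN // gM // scaler0 addr0.
Qed.

Lemma is_cochain_sgnc f : f \in is_cochain -> sgnc f \in is_cochain.
Proof.
move=> /is_cochainP[mf [N fN]]; apply/is_cochainP.
split; first exact: sgnc_multilinear.
by exists N => s /fN; rewrite /sgnc => ->; rewrite mulr0.
Qed.

Lemma is_cochain_hcomp n f : f \in is_cochain -> hcomp n f \in is_cochain.
Proof.
move=> /is_cochainP[mf [N fN]]; apply/is_cochainP.
split; first exact: hcomp_multilinear.
by exists N => s /fN; rewrite /hcomp => ->; rewrite if_same.
Qed.

Lemma is_cochain_hdiff f : f \in is_cochain -> hdiff f \in is_cochain.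
Proof.
move=> cf; rewrite hdiffE.
have ci : idc \in is_cochain.
  apply/is_cochainP; split; first exact: idc_multilinear.
  by exists 2%N => -[|x []].
have [_ cL] := is_cochain_submod.
have cB g h : g \in is_cochain -> h \in is_cochain -> g - h \in is_cochain.
  by move=> cg ch; rewrite addrC -scaleN1r cL.
apply: (cB); first by apply: (cB); apply: is_cochain_cup => //; apply: is_cochain_sgnc.
move: cf => /is_cochainP[mf bf]; apply/is_cochainP.
by split; [exact: innd_multilinear|exact: innd_bounded].
Qed.

Lemma sum_hcomp f N : (forall s, (N <= size s)%N -> f s = 0) ->
  sgnc f = \sum_(n < N) (-1) ^+ n *: hcomp n f.
Proof.
move=> fN; apply/funext => s; rewrite fct_sumE /sgnc.
have [les|lts] := leqP N (size s).
  rewrite fN // mulr0 big1 // => i _; rewrite fctZ /hcomp.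
  by case: eqP => _; rewrite ?fN // scaler0.
rewrite (bigD1 (Ordinal lts)) //= big1 ?addr0 => [|i ne].
  rewrite fctZ /hcomp eqxx -signr_odd -[in RHS]signr_odd.
  by case: odd; rewrite ?expr1 ?expr0 ?scaleN1r ?mulN1r ?scale1r ?mul1r.
rewrite fctZ /hcomp; case: eqP => E; rewrite ?scaler0 //.
by case/eqP: ne; apply: val_inj.
Qed.

End Operations.

Section Cochains.
Variables (k : fieldType) (A : algType k).

Record cochain := Cochain {
  cochain_fun :> seq A -> A;
  cochainP : cochain_fun \in @is_cochain k A
}.

HB.instance Definition _ := [isSub for cochain_fun].
HB.instance Definition _ := [Choice of cochain by <:].
HB.instance Definition _ := GRing.SubChoice_isSubLmodule.Build
  k (seq A -> A) (@is_cochain k A) cochain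
  (GRing.submod_closed_semi (@is_cochain_submod k A)).

Implicit Types f g h : cochain.

Definition cochain_mul f g : cochain :=
  Cochain (is_cochain_cup (cochainP f) (cochainP g)).
Definition cochain_one : cochain := Cochain (@is_cochain_cup1 k A).

Fact cochain_mulA : associative cochain_mul.
Proof. by move=> f g h; apply/val_inj/cupA. Qed.
Fact cochain_mul1l : left_id cochain_one cochain_mul.
Proof. by move=> f; apply/val_inj/cup1l. Qed.
Fact cochain_mul1r : right_id cochain_one cochain_mul.
Proof. by move=> f; apply/val_inj/cup1r. Qed.
Fact cochain_mulDl : left_distributive cochain_mul +%R.
Proof. by move=> f g h; apply/val_inj/cupDl. Qed.
Fact cochain_mulDr : right_distributive cochain_mul +%R.
Proof. by move=> f g h; apply/val_inj/cupDr. Qed.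
Fact cochain_one_neq0 : cochain_one != 0.
Proof.
apply/eqP => /(congr1 (fun f : cochain => f [::]))/eqP.
by rewrite [X in X == _]/= (_ : (0 : cochain) [::] = 0) // oner_eq0.
Qed.
HB.instance Definition _ := GRing.Zmodule_isNzRing.Build cochain
  cochain_mulA cochain_mul1l cochain_mul1r cochain_mulDl cochain_mulDr
  cochain_one_neq0.

Fact cochain_scalerAl (a : k) f g : a *: (f * g) = (a *: f) * g.
Proof. by apply: val_inj; rewrite /= [RHS](cupZl a f g). Qed.
HB.instance Definition _ :=
  GRing.Lmodule_isLalgebra.Build k cochain cochain_scalerAl.
Fact cochain_scalerAr (a : k) f g : a *: (f * g) = f * (a *: g).
Proof. by apply: val_inj; rewrite /= [RHS](cupZr a f g). Qed.
HB.instance Definition _ :=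
  GRing.Lalgebra_isAlgebra.Build k cochain cochain_scalerAr.

Definition diff f : cochain := Cochain (is_cochain_hdiff (cochainP f)).

Definition component n f : cochain := Cochain (is_cochain_hcomp n (cochainP f)).

Definition homogeneous n f := component n f = f.

Definition sign_inv f : cochain := Cochain (is_cochain_sgnc (cochainP f)).

Lemma diff_linear : linear diff.
Proof. by move=> a f g; apply: val_inj; rewrite /= hdiffD hdiffZ. Qed.
HB.instance Definition _ := GRing.isLinear.Build k cochain cochain _ diff diff_linear.

Lemma diff_diff f : diff (diff f) = 0.
Proof. exact/val_inj/hdiff_hdiff. Qed.

Lemma diffM f g : diff (f * g) = diff f * g + sign_inv f * diff g.
Proof. exact/val_inj/hdiff_cup. Qed.

Lemma diff_sign f : diff (sign_inv f) = - sign_inv (diff f).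
Proof. by apply: val_inj; rewrite /= -[RHS]/(- sgnc (hdiff f)) sgnc_hdiff opprK. Qed.

Lemma sign_invK : involutive sign_inv.
Proof. by move=> f; apply/val_inj/sgncK. Qed.

Lemma sign_inv_sum f :
  exists N, sign_inv f = \sum_(n < N) (-1) ^+ n *: component n f.
Proof.
have /is_cochainP[_ [N fN]] := cochainP f.
exists N; apply: val_inj; rewrite raddf_sum /= (sum_hcomp fN).
by apply: eq_bigr.
Qed.

(* Differential graded subalgebras of the standard complex.                    *)
Record subdga := SubDGA {
  subdga_pred :> {pred cochain};
  subdga_subalg : subalg_closed subdga_pred;
  subdga_diff : {in subdga_pred, forall f, diff f \in subdga_pred};
  subdga_component :
    {in subdga_pred, forall f n, component n f \in subdga_pred}
}.

Lemma full_subalg : @subalg_closed k cochain predT. Proof. by []. Qed.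

Definition full_subdga : subdga := @SubDGA predT full_subalg
  (fun _ _ => isT) (fun _ _ _ => isT).

End Cochains.


Section Cohomology.
Variables (k : fieldType) (A : algType k) (S : subdga A).

Definition is_cocycle : {pred cochain A} := fun f => (f \in S) && (diff f == 0).

Let SL a f g : f \in S -> g \in S -> a *: f + g \in S.
Proof. by have [_ + _] := subdga_subalg S; apply. Qed.
Let S1 : 1 \in S. Proof. by have [] := subdga_subalg S. Qed.
Let SM f g : f \in S -> g \in S -> f * g \in S.
Proof. by have [_ _] := subdga_subalg S; apply. Qed.
Let S0 : 0 \in S.
Proof. by rewrite -(addNr 1) -scaleN1r SL. Qed.
Let SZ a f : f \in S -> a *: f \in S.
Proof. by move=> Sf; rewrite -[X in X \in _]addr0 SL. Qed.
Let SB f g : f \in S -> g \in S -> f - g \in S.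
Proof. by move=> Sf Sg; rewrite addrC -scaleN1r SL. Qed.

Lemma subdga_sign f : f \in S -> sign_inv f \in S.
Proof.
move=> Sf; have [N ->] := sign_inv_sum f.
elim/big_rec: _ => [|i g _ Sg]; first exact: S0.
by apply: SL => //; apply: subdga_component.
Qed.

Lemma diff1 : diff (1 : cochain A) = 0.
Proof.
have /eqP := diffM (1 : cochain A) 1.
have -> : sign_inv (1 : cochain A) = 1.
  by apply/val_inj/funext => -[|x s]; rewrite /= /sgnc /= ?mulr0 ?mulr1.
by rewrite !mul1r mulr1 -subr_eq0 opprD addNKr oppr_eq0 => /eqP.
Qed.

Lemma is_cocycle_subalg : subalg_closed is_cocycle.
Proof.
split=> [|a f g /andP[Sf /eqP df] /andP[Sg /eqP dg]
         |f g /andP[Sf /eqP df] /andP[Sg /eqP dg]]; apply/andP; split.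
- exact: S1.
- by rewrite diff1.
- exact: SL.
- by rewrite linearP /= df dg scaler0 addr0.
- exact: SM.
- by rewrite diffM df dg mul0r mulr0 addr0.
Qed.

Record cocycle := Cocycle {
  cocycle_val :> cochain A;
  cocycleP : cocycle_val \in is_cocycle
}.

HB.instance Definition _ := [isSub for cocycle_val].
HB.instance Definition _ := [Choice of cocycle by <:].
HB.instance Definition _ := GRing.SubChoice_isSubAlgebra.Build
  k (cochain A) is_cocycle cocycle
  (GRing.subalg_closed_semi is_cocycle_subalg).

Definition is_boundary : {pred cocycle} :=
  fun z => `[< exists2 w, w \in S & diff w = z >].

Lemma is_boundaryP (z : cocycle) :
  reflect (exists2 w, w \in S & diff w = z) (z \in is_boundary).
Proof. exact: asboolP. Qed.

Lemma is_boundary_zmod : zmod_closed is_boundary.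
Proof.
split=> [|x y /is_boundaryP[f Sf df] /is_boundaryP[g Sg dg]]; apply/is_boundaryP.
  by exists 0; rewrite ?linear0.
by exists (f - g); rewrite ?SB // [LHS]linearB /= df dg.
Qed.

HB.instance Definition _ := GRing.isZmodClosed.Build cocycle is_boundary
  is_boundary_zmod.

Lemma is_boundaryZ (a : k) z : z \in is_boundary -> a *: z \in is_boundary.
Proof.
move=> /is_boundaryP[f Sf df]; apply/is_boundaryP; exists (a *: f).
  exact: SZ.
by rewrite [LHS]linearZ /= df.
Qed.

Lemma is_boundaryMl (y z : cocycle) : z \in is_boundary -> y * z \in is_boundary.
Proof.
have /andP[Sy /eqP dy] := cocycleP y.
move=> /is_boundaryP[f Sf df]; apply/is_boundaryP; exists (sign_inv y * f).
  by rewrite SM // subdga_sign.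
rewrite diffM diff_sign dy sign_invK df.
suff -> : sign_inv (0 : cochain A) = 0 by rewrite oppr0 mul0r add0r.
by apply/val_inj/funext => s; rewrite /= /sgnc mulr0.
Qed.

Lemma is_boundaryMr (y z : cocycle) : z \in is_boundary -> z * y \in is_boundary.
Proof.
have /andP[Sy /eqP dy] := cocycleP y.
move=> /is_boundaryP[f Sf df]; apply/is_boundaryP; exists (f * y).
  exact: SM.
by rewrite diffM dy df mulr0 addr0.
Qed.

Definition cohomology := {ideal_quot is_boundary}.

HB.instance Definition _ := GRing.Zmodule.on cohomology.

Definition coh_class (z : cocycle) : cohomology := \pi_(cohomology)%qT z.
Definition coh_repr (x : cohomology) : cocycle := generic_quotient.repr x.

Lemma coh_reprK : cancel coh_repr coh_class.
Proof. exact: reprK. Qed.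

Lemma coh_classE (y z : cocycle) :
  (coh_class y == coh_class z) = (y - z \in is_boundary).
Proof. by rewrite (Quotient.idealrBE is_boundary). Qed.

Lemma coh_classD : {morph coh_class : y z / y + z}.
Proof. exact: (Quotient.pi_add is_boundary). Qed.

Definition coh_scale (a : k) (x : cohomology) : cohomology :=
  coh_class (a *: coh_repr x).
Definition coh_one : cohomology := coh_class 1.
Definition coh_mul (x y : cohomology) : cohomology :=
  coh_class (coh_repr x * coh_repr y).

Lemma coh_reprB (z : cocycle) : coh_repr (coh_class z) - z \in is_boundary.
Proof. by rewrite -coh_classE coh_reprK. Qed.

Lemma coh_scaleE (a : k) z : coh_scale a (coh_class z) = coh_class (a *: z).
Proof. by apply/eqP; rewrite coh_classE -scalerBr is_boundaryZ // coh_reprB. Qed.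

Lemma coh_mulE y z : coh_mul (coh_class y) (coh_class z) = coh_class (y * z).
Proof.
apply/eqP; rewrite coh_classE.
rewrite -(subrKA (y * coh_repr (coh_class z))) -mulrBl -mulrBr.
by apply: rpredD; [apply: is_boundaryMr|apply: is_boundaryMl]; exact: coh_reprB.
Qed.

Fact coh_scalerA a b x : coh_scale a (coh_scale b x) = coh_scale (a * b) x.
Proof. by rewrite -[x]coh_reprK !coh_scaleE scalerA. Qed.
Fact coh_scale1r : left_id 1 coh_scale.
Proof. by move=> x; rewrite -[x]coh_reprK !coh_scaleE scale1r. Qed.
Fact coh_scalerDr : right_distributive coh_scale +%R.
Proof.
move=> a x y; rewrite -[x]coh_reprK -[y]coh_reprK.
by rewrite !(coh_scaleE, =^~ coh_classD) scalerDr.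
Qed.
Fact coh_scalerDl x : {morph coh_scale^~ x : a b / a + b}.
Proof.
by move=> a b; rewrite -[x]coh_reprK !(coh_scaleE, =^~ coh_classD) scalerDl.
Qed.
HB.instance Definition _ := GRing.Zmodule_isLmodule.Build k cohomology
  coh_scalerA coh_scale1r coh_scalerDr coh_scalerDl.

Fact coh_mulA : associative coh_mul.
Proof.
move=> x y z; rewrite -[x]coh_reprK -[y]coh_reprK -[z]coh_reprK.
by rewrite !coh_mulE mulrA.
Qed.
Fact coh_mul1l : left_id coh_one coh_mul.
Proof. by move=> x; rewrite -[x]coh_reprK coh_mulE mul1r. Qed.
Fact coh_mul1r : right_id coh_one coh_mul.
Proof. by move=> x; rewrite -[x]coh_reprK coh_mulE mulr1. Qed.
Fact coh_mulDl : left_distributive coh_mul +%R.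
Proof.
move=> x y z; rewrite -[x]coh_reprK -[y]coh_reprK -[z]coh_reprK.
by rewrite !(coh_mulE, =^~ coh_classD) mulrDl.
Qed.
Fact coh_mulDr : right_distributive coh_mul +%R.
Proof.
move=> x y z; rewrite -[x]coh_reprK -[y]coh_reprK -[z]coh_reprK.
by rewrite !(coh_mulE, =^~ coh_classD) mulrDr.
Qed.
Fact coh_one_neq0 : coh_one != 0.
Proof.
have -> : 0 = coh_class 0.
  by apply: (addrI (coh_class 0)); rewrite -coh_classD !addr0.
rewrite coh_classE subr0; apply/negP => /is_boundaryP[f _].
move=> /(congr1 (fun g : cochain A => g [::]))/esym/eqP.
by rewrite [X in X == _](_ : _ = 1) ?[X in _ == X](_ : _ = 0) ?oner_eq0.
Qed.
HB.instance Definition _ := GRing.Zmodule_isNzRing.Build cohomology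
  coh_mulA coh_mul1l coh_mul1r coh_mulDl coh_mulDr coh_one_neq0.

Fact coh_scalerAl (a : k) (x y : cohomology) : a *: (x * y) = (a *: x) * y.
Proof.
rewrite -[x]coh_reprK -[y]coh_reprK.
rewrite -[LHS]/(coh_scale a (coh_mul _ _)) -[RHS]/(coh_mul (coh_scale a _) _).
by rewrite !(coh_mulE, coh_scaleE) scalerAl.
Qed.
HB.instance Definition _ :=
  GRing.Lmodule_isLalgebra.Build k cohomology coh_scalerAl.
Fact coh_scalerAr (a : k) (x y : cohomology) : a *: (x * y) = x * (a *: y).
Proof.
rewrite -[x]coh_reprK -[y]coh_reprK.
rewrite -[LHS]/(coh_scale a (coh_mul _ _)) -[RHS]/(coh_mul _ (coh_scale a _)).
by rewrite !(coh_mulE, coh_scaleE) scalerAr.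
Qed.
HB.instance Definition _ :=
  GRing.Lalgebra_isAlgebra.Build k cohomology coh_scalerAr.

Fact coh_class_linear : linear coh_class.
Proof.
by move=> a y z; rewrite coh_classD -coh_scaleE.
Qed.
HB.instance Definition _ :=
  GRing.isLinear.Build k cocycle cohomology _ coh_class coh_class_linear.
Fact coh_class_monoid_morphism : monoid_morphism coh_class.
Proof. by split=> // y z; rewrite -coh_mulE. Qed.
HB.instance Definition _ :=
  GRing.isMonoidMorphism.Build cocycle cohomology coh_class
    coh_class_monoid_morphism.

Definition coh_degree n (x : cohomology) :=
  exists2 z : cocycle, homogeneous n z & coh_class z = x.

End Cohomology.

Definition HH (k : fieldType) (A : algType k) := cohomology (@full_subdga k A).

HB.instance Definition _ (k : fieldType) (A : algType k) :=
  GRing.Algebra.on (HH A).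

Record alg_action (gT : finGroupType) (k : fieldType) (A : algType k) :=
  AlgAction {
    aaut :> gT -> {lrmorphism A -> A};
    aaut1 : aaut 1%g =1 id;
    aautM : forall s t, aaut (s * t)%g =1 aaut s \o aaut t
  }.

Section ActionHH.
Variables (gT : finGroupType) (k : fieldType) (A : algType k).
Variable rho : alg_action gT A.
Implicit Types (s t : gT) (f g : cochain A).

Lemma aautK s : cancel (rho s) (rho s^-1%g).
Proof. by move=> x; rewrite -[LHS]/((_ \o _) x) -aautM mulVg aaut1. Qed.

Lemma aautKV s : cancel (rho s^-1%g) (rho s).
Proof. by move=> x; rewrite -[LHS]/((_ \o _) x) -aautM mulgV aaut1. Qed.

Definition fun_act s (f : seq A -> A) : seq A -> A :=
  fun l => rho s (f (map (rho s^-1%g) l)).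

Lemma fun_act_is_cochain s f : fun_act s f \in @is_cochain k A.
Proof.
have /is_cochainP[mf [N fN]] := cochainP f; apply/is_cochainP; split.
  by move=> a l1 l2 x y; rewrite /fun_act !map_cat /= linearP mf linearP.
by exists N => l leN; rewrite /fun_act fN ?size_map // linear0.
Qed.

Definition cochain_act s f : cochain A := Cochain (fun_act_is_cochain s f).

Lemma cochain_act_linear s : linear (cochain_act s).
Proof. by move=> a f g; apply/val_inj/funext => l; rewrite /= /fun_act linearP. Qed.
HB.instance Definition _ s :=
  GRing.isLinear.Build k (cochain A) (cochain A) _ (cochain_act s)
    (cochain_act_linear s).

Lemma cochain_act_monoid s : monoid_morphism (cochain_act s).
Proof.
split=> [|f g]; apply/val_inj/funext => l; rewrite /= /fun_act.
  by case: l => [|x l]; rewrite /= ?rmorph1 ?rmorph0.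
rewrite /cup size_map rmorph_sum /=.
by apply: eq_bigr => i _; rewrite rmorphM -map_take -map_drop.
Qed.
HB.instance Definition _ s :=
  GRing.isMonoidMorphism.Build (cochain A) (cochain A) (cochain_act s)
    (cochain_act_monoid s).

Lemma cochain_act1 : cochain_act 1 =1 id.
Proof.
move=> f; apply/val_inj/funext => l; rewrite /= /fun_act aaut1 invg1.
by rewrite (eq_map (aaut1 rho)) map_id.
Qed.

Lemma cochain_actM s t f :
  cochain_act (s * t) f = cochain_act s (cochain_act t f).
Proof.
apply/val_inj/funext => l; rewrite /= /fun_act aautM invMg -map_comp.
by rewrite (eq_map (aautM rho _ _)).
Qed.

Lemma diff_act s f : diff (cochain_act s f) = cochain_act s (diff f).
Proof.
apply/val_inj/funext => -[|x l]; rewrite /= /fun_act /= ?linear0 //.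
rewrite !rmorphD !rmorphM /= aautKV size_map rmorph_sum /=.
rewrite -[RHS]/(_ + _ + (rho s ((-1) ^+ _) * _)) rmorphXn rmorphN1.
rewrite -[size l]/(size l) belast_map last_map aautKV.
congr (_ + _ + _).
apply: eq_bigr => i _; rewrite rmorphM rmorphXn rmorphN1; congr (_ * rho s (f _)).
rewrite /contract -!map_cons map_cat map_take /= map_drop.
by rewrite -!map_cons !(nth_map 0) ?rmorphM //= ?ltnS // ltnW // ltnS.
Qed.

Lemma act_is_cocycle s (z : cocycle (full_subdga A)) :
  cochain_act s z \in is_cocycle (full_subdga A).
Proof.
have /andP[_ /eqP dz] := cocycleP z.
by apply/andP; split; rewrite // diff_act dz linear0.
Qed.

Definition cocycle_act s (z : cocycle (full_subdga A)) : cocycle (full_subdga A) :=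
  Cocycle (act_is_cocycle s z).

Definition HH_act s (x : HH A) : HH A := coh_class (cocycle_act s (coh_repr x)).

Lemma HH_actE s z : HH_act s (coh_class z) = coh_class (cocycle_act s z).
Proof.
apply/eqP; rewrite coh_classE.
have /is_boundaryP[f _ df] := coh_reprB z.
apply/is_boundaryP; exists (cochain_act s f) => //.
by rewrite diff_act df -[LHS]/(cochain_act s (cocycle_val _ - cocycle_val _)) linearB.
Qed.

Lemma HH_act_linear s : linear (HH_act s).
Proof.
move=> a x y; rewrite -[x]coh_reprK -[y]coh_reprK -linearP !HH_actE -linearP.
by congr coh_class; apply: val_inj; rewrite /= [LHS]linearP.
Qed.
HB.instance Definition _ s :=
  GRing.isLinear.Build k (HH A) (HH A) _ (HH_act s) (HH_act_linear s).

Lemma HH_act_monoid s : monoid_morphism (HH_act s).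
Proof.
split=> [|x y].
  rewrite -[1]/(coh_class 1) HH_actE; congr coh_class.
  by apply: val_inj; rewrite /= [LHS]rmorph1.
rewrite -[x]coh_reprK -[y]coh_reprK -rmorphM !HH_actE -rmorphM.
by congr coh_class; apply: val_inj; rewrite /= [LHS]rmorphM.
Qed.
HB.instance Definition _ s :=
  GRing.isMonoidMorphism.Build (HH A) (HH A) (HH_act s) (HH_act_monoid s).

Lemma HH_act1 : HH_act 1 =1 id.
Proof.
move=> x; rewrite -[x]coh_reprK HH_actE; congr coh_class.
by apply: val_inj; rewrite /= cochain_act1.
Qed.

Lemma HH_actM s t x : HH_act (s * t) x = HH_act s (HH_act t x).
Proof.
rewrite -[x]coh_reprK !HH_actE; congr coh_class.
by apply: val_inj; rewrite /= cochain_actM.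
Qed.

Definition is_invariant : {pred HH A} :=
  fun x => [forall s : gT, HH_act s x == x].

Lemma is_invariant_subalg : subalg_closed is_invariant.
Proof.
split=> [|a x y /forallP ix /forallP iy|x y /forallP ix /forallP iy];
  apply/forallP => s.
- by rewrite rmorph1.
- by rewrite linearP /= (eqP (ix s)) (eqP (iy s)).
- by rewrite rmorphM /= (eqP (ix s)) (eqP (iy s)).
Qed.

(* The subalgebra of invariants of G in HH A.                                  *)
Record HHinv := HHInv { HHinv_val :> HH A; _ : HHinv_val \in is_invariant }.
HB.instance Definition _ := [isSub for HHinv_val].
HB.instance Definition _ := [Choice of HHinv by <:].
HB.instance Definition _ := GRing.SubChoice_isSubAlgebra.Build
  k (HH A) is_invariant HHinv (GRing.subalg_closed_semi is_invariant_subalg).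

End ActionHH.

Section GradedAlgebra.
Variables (gT : finGroupType) (k : fieldType) (B : algType k).

Record grading := Grading {
  gcomp : gT -> {pred B};
  gcomp_submod : forall s, submod_closed (gcomp s);
  gcomp_decomp : forall b, exists2 c : gT -> B,
    (forall s, c s \in gcomp s) & b = \sum_s c s;
  gcomp_direct : forall c : gT -> B,
    (forall s, c s \in gcomp s) -> \sum_s c s = 0 -> forall s, c s = 0;
  gcomp1 : 1 \in gcomp 1%g;
  gcompM : forall s t x y, x \in gcomp s -> y \in gcomp t ->
    x * y \in gcomp (s * t)%g
}.

Variable gr : grading.

(* For a homogeneous list of pairs l = [:: (s_n, b_n); ...; (s_1, b_1)] with    *)
(* b_i in B^{s_i}, the value f [:: b_n; ...; b_1] lies in B^{s_n ... s_1}.      *)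
Definition graded_list (l : seq (gT * B)) := all (fun p => p.2 \in gcomp gr p.1) l.

Definition is_graded : {pred cochain B} := fun f =>
  `[< forall l, graded_list l ->
        f (map snd l) \in gcomp gr (\prod_(p <- l) p.1)%g >].

Lemma is_gradedP (f : cochain B) : reflect
  (forall l, graded_list l -> f (map snd l) \in gcomp gr (\prod_(p <- l) p.1)%g)
  (f \in is_graded).
Proof. exact: asboolP. Qed.

Let cL s a x y : x \in gcomp gr s -> y \in gcomp gr s -> a *: x + y \in gcomp gr s.
Proof. by have [_] := gcomp_submod gr s; apply. Qed.
Let c0 s : 0 \in gcomp gr s.
Proof. by have [] := gcomp_submod gr s. Qed.
Let cB s x y : x \in gcomp gr s -> y \in gcomp gr s -> x - y \in gcomp gr s.
Proof. by move=> sx sy; rewrite addrC -scaleN1r cL. Qed.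
Let cD s x y : x \in gcomp gr s -> y \in gcomp gr s -> x + y \in gcomp gr s.
Proof. by move=> sx sy; rewrite -[x]scale1r cL. Qed.
Let csign s n x : x \in gcomp gr s -> (-1) ^+ n * x \in gcomp gr s.
Proof.
rewrite -signr_odd; case: odd; rewrite ?expr0 ?expr1 ?mul1r // mulN1r => sx.
by rewrite -sub0r cB.
Qed.

Let graded_at s (f : seq B -> B) := forall l, graded_list l ->
  f (map snd l) \in gcomp gr (s * \prod_(p <- l) p.1)%g.

Let graded_at1 f : (forall l, graded_list l ->
   f (map snd l) \in gcomp gr (\prod_(p <- l) p.1)%g) <-> graded_at 1 f.
Proof. by split=> fg l /fg; rewrite mul1g. Qed.

Let graded_cup f g : graded_at 1 f -> graded_at 1 g -> graded_at 1 (cup f g).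
Proof.
move=> /graded_at1 fg /graded_at1 gg; apply/graded_at1 => l hl.
rewrite /cup; elim/big_rec: _ => [|i x _ hx]; first exact: c0.
apply: cD => //; rewrite -map_take -map_drop -[l in (\prod_(p <- l) _)%g](cat_take_drop i).
move: hl; rewrite /graded_list -{1}[l](cat_take_drop i) all_cat => /andP[h1 h2].
by rewrite big_cat gcompM ?fg ?gg.
Qed.

Let graded_innd s f : graded_at s f -> graded_at s (innd f).
Proof.
move=> fg l; elim: l s f fg => [|[t x] [|[u y] l] IH] s f fg hl; rewrite ?c0 //.
have innd_cons2 (F : seq B -> B) a b w :
  innd F [:: a, b & w] = F (a * b :: w) - innd (peel a F) (b :: w) by [].
rewrite !map_cons innd_cons2; case/and3P: hl => /= hx hy hl.
apply: cB.
  have /fg : graded_list (((t * u)%g, x * y) :: l) by rewrite /= gcompM.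
  by rewrite !big_cons /= !mulgA.
rewrite big_cons mulgA /=; apply: (IH _ (peel x f)); last by rewrite /= hy.
move=> l' hl'; have /fg : graded_list ((t, x) :: l') by rewrite /= hx.
by rewrite big_cons mulgA.
Qed.

Let graded_sgnc s f : graded_at s f -> graded_at s (sgnc f).
Proof. by move=> fg l /fg; apply: csign. Qed.

Lemma is_graded_subalg : subalg_closed is_graded.
Proof.
split=> [|a f g /is_gradedP fg /is_gradedP gg|f g /is_gradedP fg /is_gradedP gg];
  apply/is_gradedP.
- by move=> [|p l] _; rewrite ?c0 // big_nil gcomp1.
- by move=> l hl; apply: cL; [exact: fg|exact: gg].
- by apply/graded_at1/graded_cup; apply/graded_at1.
Qed.

Lemma is_graded_diff : {in is_graded, forall f, diff f \in is_graded}.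
Proof.
move=> f /is_gradedP/graded_at1 fg; apply/is_gradedP/graded_at1 => l hl.
have ig : graded_at 1 (@idc k B).
  move=> [|[t x] [|p l']]; rewrite /= ?c0 // => /andP[hx _].
  by rewrite big_cons big_nil mulg1 mul1g.
rewrite /= hdiffE; apply: cB; first apply: cB.
- exact: graded_cup.
- by apply: graded_cup => //; apply: graded_sgnc.
- exact: graded_innd.
Qed.

Lemma is_graded_component :
  {in is_graded, forall f n, component n f \in is_graded}.
Proof.
move=> f /is_gradedP fg n; apply/is_gradedP => l hl /=.
by rewrite /hcomp; case: eqP => _; rewrite ?c0 ?fg.
Qed.

Definition graded_subdga : subdga B :=
  SubDGA is_graded_subalg is_graded_diff is_graded_component.

(* The component of HH^*(B) for the conjugacy class {1}.                        *)
Definition HH_id := cohomology graded_subdga.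

HB.instance Definition _ := GRing.Algebra.on HH_id.

End GradedAlgebra.

Section SkewGroupAlgebra.
Variables (gT : finGroupType) (k : fieldType) (A : algType k).

(* A @ kG, the function f standing for \sum_s (f s) @ s. The phantom argument   *)
(* keeps this type apart from {ffun gT -> A} with its pointwise product.       *)
Definition skew_of (_ : alg_action gT A) := {ffun gT -> A}.

Variable rho : alg_action gT A.
Local Notation skew := (skew_of rho).
HB.instance Definition _ := GRing.Lmodule.on skew.
Implicit Types f g h : skew.

Definition skew_tensor (a : A) (s : gT) : skew :=
  [ffun t => if t == s then a else 0].

Definition skew_one : skew := skew_tensor 1 1%g.

Definition skew_mul f g : skew :=
  [ffun u => \sum_s f s * rho s (g (s^-1 * u)%g)].

Lemma skew_mulE a b s t : skew_mul (skew_tensor a s) (skew_tensor b t) =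
  skew_tensor (a * rho s b) (s * t)%g.
Proof.
apply/ffunP => u; rewrite !ffunE (bigD1 s) //= big1 => [|r /negPf nr].
  rewrite !ffunE eqxx addr0 -(inj_eq (mulgI s)) mulKVg.
  by case: eqP; rewrite // rmorph0 mulr0.
by rewrite ffunE nr mul0r.
Qed.

Fact skew_mulA : associative skew_mul.
Proof.
move=> f g h; apply/ffunP => u; rewrite !ffunE.
under [RHS]eq_bigr do rewrite ffunE mulr_suml.
rewrite exchange_big /=; apply: eq_bigr => s _.
rewrite ffunE rmorph_sum mulr_sumr [RHS](reindex_inj (mulgI s)) /=.
apply: eq_bigr => t _.
by rewrite mulKg aautM rmorphM /= mulrA invMg mulgA.
Qed.

Fact skew_mul1l : left_id skew_one skew_mul.
Proof.
move=> f; apply/ffunP => u; rewrite !ffunE (bigD1 1%g) //= big1 => [|s /negPf ns].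
  by rewrite ffunE eqxx aaut1 mul1r invg1 mul1g addr0.
by rewrite ffunE ns mul0r.
Qed.

Fact skew_mul1r : right_id skew_one skew_mul.
Proof.
move=> f; apply/ffunP => u; rewrite !ffunE (bigD1 u) //= big1 => [|s ns].
  by rewrite ffunE mulVg eqxx rmorph1 mulr1 addr0.
rewrite ffunE -(inj_eq (mulgI s)) mulKVg mulg1 eq_sym (negPf ns).
by rewrite rmorph0 mulr0.
Qed.

Fact skew_mulDl : left_distributive skew_mul +%R.
Proof.
move=> f g h; apply/ffunP => u; rewrite !ffunE -big_split /=.
by apply: eq_bigr => s _; rewrite ffunE mulrDl.
Qed.

Fact skew_mulDr : right_distributive skew_mul +%R.
Proof.
move=> f g h; apply/ffunP => u; rewrite !ffunE -big_split /=.
by apply: eq_bigr => s _; rewrite ffunE rmorphD mulrDr.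
Qed.

Fact skew_one_neq0 : skew_one != 0.
Proof.
apply/eqP => /ffunP/(_ 1%g); rewrite !ffunE eqxx => /eqP.
by rewrite oner_eq0.
Qed.

HB.instance Definition _ := GRing.Zmodule_isNzRing.Build skew
  skew_mulA skew_mul1l skew_mul1r skew_mulDl skew_mulDr skew_one_neq0.

Fact skew_scalerAl (a : k) f g : a *: (f * g) = (a *: f) * g.
Proof.
apply/ffunP => u; rewrite !ffunE scaler_sumr.
by apply: eq_bigr => s _; rewrite ffunE scalerAl.
Qed.
HB.instance Definition _ := GRing.Lmodule_isLalgebra.Build k skew skew_scalerAl.

Fact skew_scalerAr (a : k) f g : a *: (f * g) = f * (a *: g).
Proof.
apply/ffunP => u; rewrite !ffunE scaler_sumr.
by apply: eq_bigr => s _; rewrite ffunE linearZ /= scalerAr.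
Qed.
HB.instance Definition _ := GRing.Lalgebra_isAlgebra.Build k skew skew_scalerAr.

(* The component A @ s.                                                        *)
Definition skew_comp (s : gT) : {pred skew} :=
  fun f => [forall t, (t != s) ==> (f t == 0)].

Lemma skew_compP s f : reflect (exists a, f = skew_tensor a s) (f \in skew_comp s).
Proof.
apply: (iffP forallP) => [fs|[a ->] t]; last first.
  by apply/implyP => /negPf nts; rewrite ffunE nts.
exists (f s); apply/ffunP => t; rewrite ffunE.
by have := fs t; case: eqP => [->//|_ /eqP].
Qed.

Lemma skew_tensorP a s : skew_tensor a s \in skew_comp s.
Proof. by apply/skew_compP; exists a. Qed.

Fact skew_comp_submod s : submod_closed (skew_comp s).
Proof.
split=> [|a f g /skew_compP[x ->] /skew_compP[y ->]]; apply/skew_compP.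
  by exists 0; apply/ffunP => t; rewrite !ffunE if_same.
exists (a *: x + y); apply/ffunP => t; rewrite !ffunE.
by case: eqP; rewrite // scaler0 addr0.
Qed.

Lemma skew_sum f : f = \sum_s skew_tensor (f s) s.
Proof.
apply/ffunP => t; rewrite sum_ffunE (bigD1 t) //= big1 => [|s /negPf ns].
  by rewrite ffunE eqxx addr0.
by rewrite ffunE eq_sym ns.
Qed.

Fact skew_comp_decomp f : exists2 c : gT -> skew,
  (forall s, c s \in skew_comp s) & f = \sum_s c s.
Proof.
by exists (fun s => skew_tensor (f s) s); [move=> s; exact: skew_tensorP|exact: skew_sum].
Qed.

Fact skew_comp_direct (c : gT -> skew) :
  (forall s, c s \in skew_comp s) -> \sum_s c s = 0 -> forall s, c s = 0.
Proof.
move=> cs c0 s; have /skew_compP[a E] := cs s.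
move: c0 => /ffunP/(_ s); rewrite sum_ffunE (bigD1 s) //= big1 => [|t nts].
  by rewrite E !ffunE eqxx addr0 => ->; apply/ffunP => t; rewrite !ffunE if_same.
by have /skew_compP[b ->] := cs t; rewrite ffunE eq_sym (negPf nts).
Qed.

Fact skew_comp1 : 1 \in skew_comp 1%g.
Proof. exact: skew_tensorP. Qed.

Fact skew_compM s t f g : f \in skew_comp s -> g \in skew_comp t ->
  f * g \in skew_comp (s * t)%g.
Proof.
move=> /skew_compP[a ->] /skew_compP[b ->].
by rewrite [_ * _]skew_mulE skew_tensorP.
Qed.

Definition skew_grading : grading gT skew := Grading skew_comp_submod
  skew_comp_decomp skew_comp_direct skew_comp1 skew_compM.

End SkewGroupAlgebra.

(* Main.v *)
Require Import Defs.
From HB Require Import structures.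
From mathcomp Require Import all_boot all_order all_algebra all_fingroup.
From mathcomp Require Import boolp functions.

Set Implicit Arguments.
Unset Strict Implicit.
Unset Printing Implicit Defensive.

Import GRing.Theory.
Local Open Scope ring_scope.

(** Write B for the skew group algebra, U u for the element 1 @ u, C for the
graded cochains of B, and embed L in B as the component of 1.

Restricting a graded cochain to L gives a morphism of differential graded
algebras [restrict] from C to the standard complex of L. In the other direction
a cochain f of L extends to the graded cochain [extend f] with
  (a_1 @ s_1, ..., a_n @ s_n) |->
     f (a_1, s_1 a_2, s_1 s_2 a_3, ..., s_1 ... s_(n-1) a_n) @ s_1 ... s_n,
which restricts to f. If f is G-invariant, [extend f] is the unique extension
that is linear over kG in the relative sense, and [extend] commutes with the
differential on such f. Since |G| is invertible, any cochain of L can be averaged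
into an invariant one.

What has to be shown is that [extend \o average \o restrict] is homotopic to the
identity of C. In terms of the bar resolution of B, this composite comes from the
chain map that replaces b_0 @ b_1 @ ... @ b_(n+1) by
  b_0 u_0^-1 @ u_0 b_1 u_1^-1 @ ... @ u_(n-1) b_n u_n^-1 @ u_n b_(n+1),
where u_0 = U u, where u_i = U (u s_1 ... s_i) if the b_i are homogeneous of
degree s_i, and where one takes the mean over u in G. The entries between the
outer two then all lie in L. Like a natural isomorphism of functors, the family
(u_i) gives a prismatic homotopy, the alternating sum over i of the terms
  b_0 u_0^-1 @ u_0 b_1 u_1^-1 @ ... @ u_(i-1) b_i u_i^-1 @ u_i @ b_(i+1) @ ....
The mean over u is needed only for the face that multiplies b_0 and b_1, which
replaces the starting point u by u s_1. The homotopy is [homotopy], its defining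
property [homotopyP]; the two lemmas that carry it are [contr_rdiff], for all
faces but the leftmost one, and [homotopy_idc] for the leftmost one.

The theorem follows formally. The homotopy shows that a restricted cocycle is
cohomologous to its average, hence has an invariant class, and that a cocycle with
restriction [diff w] is the differential of an explicit graded cochain. An
invariant class contains the average of any of its cocycles, and this average
extends. Restriction, average and extension preserve the degree, so the
isomorphism is one of graded algebras. *)

(** * The differential without its leftmost face *)

Section RightDifferential.
Variables (k : fieldType) (A : algType k).
Implicit Types (f g : seq A -> A) (s t : seq A) (x y : A).

(** An inner face of the Hochschild differential as long as an argument is left,
its last face otherwise. *)
Definition mulhead x f : seq A -> A :=
  fun t => if t is y :: u then f (x * y :: u) else f [::] * x.

(** The Hochschild differential without the face x * f t. Its recursion treats
the inner faces and the last one alike, which is what makes it suitable for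
inductions on the list of arguments. *)
Fixpoint rdiff f s : A :=
  if s is x :: t then - (rdiff (peel x f) t + mulhead x f t) else 0.

Lemma hdiff_rdiff f : hdiff f = cup (@idc k A) f + rdiff f.
Proof.
rewrite hdiffE -addrA; congr (_ + _); apply/funext => s; rewrite fctD !fctN.
elim: s f => [|x t IH] f; first by rewrite cup_nil /= mulr0 oppr0 addr0.
rewrite cup_cons sgnc_cons cupNl fctN /= -IH /mulhead.
case: t {IH} => [|y t] /=.
  by rewrite cup_nil /sgnc /= mulr0 mul1r !(subr0, oppr0, add0r).
rewrite -/(innd (peel x f) (y :: t)) mulr0 add0r opprK.
by rewrite !(opprD, opprK) -addrA; congr (_ + _); apply: addrC.
Qed.

Lemma rdiff_linear : linear rdiff.
Proof.
move=> a f g; apply/funext => s; rewrite fctD fctZ.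
elim: s f g => [|x t IH] f g /=; first by rewrite scaler0 addr0.
rewrite shiftD shiftZ IH scalerN -opprD; congr (- _).
rewrite scalerDr addrACA; congr (_ + _).
by case: t {IH} => [|y u] //=; rewrite fctD fctZ mulrDl scalerAl.
Qed.
HB.instance Definition _ :=
  GRing.isLinear.Build k (seq A -> A) (seq A -> A) _ rdiff rdiff_linear.

Lemma rdiff_mull (z : A) f s : rdiff (fun l => z * f l) s = z * rdiff f s.
Proof.
elim: s f => [|x t IH] f /=; first by rewrite mulr0.
rewrite mulrN mulrDr -IH; congr (- (_ + _)).
by case: t {IH} => [|y u] //=; rewrite mulrA.
Qed.

Lemma peel0 f : multilinear f -> peel 0 f = 0.
Proof.
by move=> mf; have := peel_lin (-1) 0 0 mf; rewrite scaleN1r oppr0 addr0 scaleN1r addNr.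
Qed.

Lemma peel_sum (I : finType) (F : I -> A) f : multilinear f ->
  peel (\sum_i F i) f = \sum_i peel (F i) f.
Proof.
move=> mf; pose h : A -> seq A -> A := fun x => peel x f.
have hl : linear h by move=> a x y; apply: peel_lin.
pose hL := GRing.isLinear.Build k A (seq A -> A) _ h hl.
pose hh : {linear A -> (seq A -> A)} := HB.pack h hL.
exact: (raddf_sum hh).
Qed.

End RightDifferential.

(** * Sums of cochains, vanishing classes, and restriction along a morphism *)

Lemma cochain_sumE (k : fieldType) (A : algType k) (I : finType)
  (F : I -> cochain A) s : (\sum_i F i) s = \sum_i F i s.
Proof. by elim/big_rec2: _ => // i x f _ <-. Qed.

Lemma coh_class_eq0 (k : fieldType) (A : algType k) (S : subdga A) (z : cocycle S) :
  coh_class z = 0 <-> z \in @is_boundary k A S.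
Proof.
rewrite -[z in X in _ <-> X]subr0 -coh_classE (linear0 (@coh_class k A S)).
by split=> /eqP.
Qed.

(** A cochain g of B that sends i(A) to i(A) as f does may be seen as an
extension of f; the formulas for cup and hdiff then restrict to A, as i is a ring
morphism. *)
Section MapCochains.
Variables (k : fieldType) (A B : algType k) (i : {rmorphism A -> B}).
Variables (f f' : seq A -> A) (g g' : seq B -> B).
Hypothesis fg : forall l, g (map i l) = i (f l).
Hypothesis fg' : forall l, g' (map i l) = i (f' l).

Lemma cup_map l : cup g g' (map i l) = i (cup f f' l).
Proof.
rewrite /cup size_map rmorph_sum; apply: eq_bigr => j _.
by rewrite rmorphM -fg -fg' map_take map_drop.
Qed.

Lemma hdiff_map l : hdiff g (map i l) = i (hdiff f l).
Proof.
case: l => [|x l] /=; first by rewrite rmorph0.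
rewrite belast_map last_map !fg !rmorphD !rmorphM rmorph_sum !rmorphXn rmorphN1.
rewrite size_map; congr (_ + _ + _); apply: eq_bigr => j _.
rewrite rmorphM rmorphXn rmorphN1 -fg; congr (_ * g _).
rewrite /contract -!map_cons map_cat map_take /= map_drop.
by rewrite -!map_cons !(nth_map 0) ?rmorphM //= ?ltnS // ltnW // ltnS.
Qed.

End MapCochains.

(** * The skew group algebra *)

Section Skew.
Variables (k : fieldType) (gT : finGroupType) (L : algType k).
Variable rho : alg_action gT L.
Local Notation B := (skew_of rho).
Implicit Types (f g : seq L -> L) (h : seq B -> B) (u v s : gT).

Definition skew_unit u : B := skew_tensor rho 1 u.
Definition skew_const (a : L) : B := skew_tensor rho a 1%g.

Lemma skew_tensor_linear s : linear ((skew_tensor rho)^~ s).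
Proof.
move=> a x y; apply/ffunP => t; rewrite !ffunE.
by case: eqP; rewrite // scaler0 addr0.
Qed.

(** [skew_mulE] for the product of the ring structure. *)
Lemma skew_mulTE a b s t : skew_tensor rho a s * skew_tensor rho b t =
  skew_tensor rho (a * rho s b) (s * t)%g.
Proof. exact: skew_mulE. Qed.

HB.instance Definition _ :=
  GRing.isLinear.Build k L B _ skew_const (skew_tensor_linear 1%g).

Lemma skew_const_monoid : monoid_morphism skew_const.
Proof. by split=> // a b; rewrite skew_mulTE mulg1 aaut1. Qed.
HB.instance Definition _ :=
  GRing.isMonoidMorphism.Build L B skew_const skew_const_monoid.

Lemma skew_constK a : skew_const a 1%g = a.
Proof. by rewrite ffunE eqxx. Qed.

Lemma skew_const_unit a u : skew_const a * skew_unit u = skew_tensor rho a u.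
Proof. by rewrite skew_mulTE rmorph1 mulr1 mul1g. Qed.

Lemma skew_unit_tensor u a s :
  skew_unit u * skew_tensor rho a s = skew_tensor rho (rho u a) (u * s)%g.
Proof. by rewrite skew_mulTE mul1r. Qed.

Lemma skew_unitVM u : skew_unit u^-1 * skew_unit u = 1.
Proof. by rewrite skew_mulTE rmorph1 mulr1 mulVg. Qed.

Lemma skew_unit_sum u (b : B) :
  skew_unit u * b = \sum_s skew_const (rho u (b s)) * skew_unit (u * s)%g.
Proof.
rewrite {1}[b]skew_sum mulr_sumr; apply: eq_bigr => s _.
by rewrite skew_unit_tensor skew_const_unit.
Qed.

(** * Equivariant extension and contraction on homogeneous arguments *)

(** On homogeneous arguments b_i = a_i @ s_i the value is
f (u a_1, u s_1 a_2, ..., u s_1 ... s_(n-1) a_n) @ u s_1 ... s_n. The sums over s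
run over the homogeneous components, so that the value is linear in each b_i.
The parameter u is the degree accumulated so far. *)
Fixpoint equiext u f (l : seq B) : B :=
  if l is b :: l' then \sum_s equiext (u * s)%g (peel (rho u (b s)) f) l'
  else skew_tensor rho (f [::]) u.

(** The prismatic homotopy for a fixed starting point u. On homogeneous arguments
b_i = a_i @ s_i it is the alternating sum over i of the terms
h (c_1, ..., c_i, U (u s_1 ... s_i), b_(i+1), ..., b_n), where
c_j = u s_1 ... s_(j-1) a_j lies in L. The recursion separates the term i = 0
from those that begin with c_1. *)
Fixpoint contr u h (l : seq B) : B :=
  if l is b :: l' then h (skew_unit u :: l)
    - \sum_s contr (u * s)%g (peel (skew_const (rho u (b s))) h) l'
  else h [:: skew_unit u].

Lemma equiext_linear u : linear (equiext u).
Proof.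
move=> a f g; apply/funext => l; rewrite fctD fctZ.
elim: l u f g => [|b l IH] u f g /=; first exact: skew_tensor_linear.
rewrite scaler_sumr -big_split; apply: eq_bigr => s _ /=.
by rewrite shiftD shiftZ IH.
Qed.
HB.instance Definition _ u :=
  GRing.isLinear.Build k (seq L -> L) (seq B -> B) _ (equiext u) (equiext_linear u).

Lemma contr_linear u : linear (contr u).
Proof.
move=> a f g; apply/funext => l; rewrite fctD fctZ.
elim: l u f g => [|b l IH] u f g //=.
rewrite scalerBr addrACA -opprD; congr (_ - _).
rewrite scaler_sumr -big_split; apply: eq_bigr => s _ /=.
by rewrite shiftD shiftZ IH.
Qed.
HB.instance Definition _ u :=
  GRing.isLinear.Build k (seq B -> B) (seq B -> B) _ (contr u) (contr_linear u).

Lemma contr_mull u (z : B) h l : contr u (fun l' => z * h l') l = z * contr u h l.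
Proof.
elim: l u h => [|b l IH] u h //=; rewrite mulrBr mulr_sumr; congr (_ - _).
by apply: eq_bigr => s _; rewrite -IH.
Qed.

(** Multiplying b into the next argument can be done before or after [contr],
since the degree accumulated after both arguments is the same. The middle term
compensates for the leading terms of the summands, in which c_1 is multiplied
into the inserted group element: by [skew_unit_sum], these products c_1 * U (u s)
add up to U u * b. *)
Lemma contr_mulhead u b h l : multilinear h ->
  mulhead b (contr u h) l = mulhead b (peel (skew_unit u) h) l
    - h (skew_unit u * b :: l)
    + \sum_s contr (u * s)%g (mulhead (skew_const (rho u (b s))) h) l.
Proof.
move=> mh.
have hs (t : seq B) : h (skew_unit u * b :: t) =
    \sum_s h (skew_const (rho u (b s)) * skew_unit (u * s)%g :: t).
  rewrite skew_unit_sum -[LHS]/(peel _ h t) peel_sum //.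
  by rewrite fct_sumE.
case: l => [|b' l] /=; first by rewrite hs subrK.
rewrite sumrB -hs addrA subrK; congr (_ - _).
(* Both sides sum over the degrees s of b and t of b'; on the left only the
   degree s t of the product b b' is summed over, whence the reindexing. *)
pose F s t := contr (u * (s * t))%g
   (peel (skew_const (rho u (b s) * rho (u * s)%g (b' t))) h) l.
transitivity (\sum_s \sum_t F s t); last first.
  apply: eq_bigr => s _; apply: eq_bigr => t _.
  by rewrite /F mulgA rmorphM.
have -> : \sum_s \sum_t F s t = \sum_s \sum_t F s (s^-1 * t)%g.
  by apply: eq_bigr => s _; rewrite (reindex_inj (mulgI s^-1%g)).
rewrite exchange_big /=; apply: eq_bigr => t _.
rewrite /F ffunE rmorph_sum raddf_sum peel_sum // raddf_sum fct_sumE.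
by apply: eq_bigr => s _; rewrite mulKVg aautM -[(_ \o _) _]/(rho u (rho s _)) -rmorphM.
Qed.

(** For all faces but the leftmost one, the prismatic homotopy telescopes down to
its last prism face, in which all arguments of h have been moved into L. There h
takes the values of f, and U (u s_1 ... s_n) is multiplied from the right. The
term of the identity, on the other end, needs the leftmost face, see
[homotopy_idc]. *)
Lemma contr_rdiff u f h l : multilinear h ->
  (forall t, h (map skew_const t) = skew_const (f t)) ->
  contr u (rdiff h) l + rdiff (contr u h) l = - equiext u f l.
Proof.
elim: l u f h => [|b l IH] u f h mh fh.
  by rewrite /= add0r addr0 (fh [::]) skew_const_unit.
pose c s := skew_const (rho u (b s)).
pose D := \sum_s rdiff (contr (u * s)%g (peel (c s) h)) l.
pose S := \sum_s contr (u * s)%g (rdiff (peel (c s) h)) l.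
pose M := \sum_s contr (u * s)%g (mulhead (c s) h) l.
pose p := rdiff (peel b (peel (skew_unit u) h)) l.
pose q := mulhead b (peel (skew_unit u) h) l.
pose r := h (skew_unit u * b :: l).
have -> : contr u (rdiff h) (b :: l) = p + q - r + (S + M).
  rewrite /= -/p -/q -/r opprD opprK; congr (_ + _).
  rewrite -sumrN -big_split; apply: eq_bigr => s _ /=.
  rewrite (_ : peel _ _ = - (rdiff (peel (c s) h) + mulhead (c s) h)) //.
  by rewrite raddfN raddfD fctN opprK.
have -> : rdiff (contr u h) (b :: l) = - (p - D + (q - r + M)).
  rewrite /= contr_mulhead // (_ : peel b _ =
    peel b (peel (skew_unit u) h) - \sum_s contr (u * s)%g (peel (c s) h)).
    by rewrite raddfB raddf_sum fctD fctN fct_sumE.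
  by apply/funext => t; rewrite fctD fctN fct_sumE.
have -> : - equiext u f (b :: l) = S + D.
  rewrite -sumrN -big_split; apply: eq_bigr => s _ /=.
  rewrite (IH _ (peel (rho u (b s)) f)) //; first exact: peel_multilinear.
  by move=> t; rewrite /peel -fh.
apply/eqP; rewrite subr_eq; apply/eqP.
by rewrite [RHS](AC (2*(2*(2*1))) (3*5*6*(1*7)*(2*4))) /= subrr addr0.
Qed.

(** The dependence of [equiext] on its starting point: changing it amounts to
acting on f, so that an average over u becomes an average of f. *)
Lemma equiext_unit u v f l :
  skew_unit v * equiext u f l = equiext (v * u)%g (fun_act rho v f) l.
Proof.
elim: l u f => [|b l IH] u f /=; first exact: skew_unit_tensor.
rewrite mulr_sumr; apply: eq_bigr => s _; rewrite IH mulgA; congr (equiext _ _ l).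
by apply/funext => t; rewrite /peel /fun_act /= aautM /= aautK.
Qed.

Lemma equiext_tensor u f a s l : multilinear f ->
  equiext u f (skew_tensor rho a s :: l) = equiext (u * s)%g (peel (rho u a) f) l.
Proof.
move=> mf /=; rewrite (bigD1 s) //= big1 => [|v /negPf nvs].
  by rewrite ffunE eqxx addr0.
by rewrite ffunE nvs rmorph0 peel0 // linear0.
Qed.

Lemma contr_tensor u h a s l : multilinear h ->
  contr u h (skew_tensor rho a s :: l) = h (skew_unit u :: skew_tensor rho a s :: l)
    - contr (u * s)%g (peel (skew_const (rho u a)) h) l.
Proof.
move=> mh /=; congr (_ - _); rewrite (bigD1 s) //= big1 => [|v /negPf nvs].
  by rewrite ffunE eqxx addr0.
by rewrite ffunE nvs rmorph0 linear0 peel0 // linear0.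
Qed.

Lemma equiext_const f l : multilinear f ->
  equiext 1 f (map skew_const l) = skew_const (f l).
Proof.
elim: l f => [|a l IH] f mf //.
by rewrite map_cons equiext_tensor // aaut1 mulg1 IH //; apply: peel_multilinear.
Qed.

Local Notation gr := (skew_grading rho).

(** * Gradings, multilinearity and degrees *)

Lemma equiext_graded u f l : multilinear f -> graded_list gr l ->
  equiext u f (map snd l) \in gcomp gr (u * \prod_(p <- l) p.1)%g.
Proof.
elim: l u f => [|[s b] l IH] u f mf /=.
  by rewrite big_nil mulg1 => _; apply: skew_tensorP.
move=> /andP[/skew_compP[a /= ->] hl]; rewrite -/(equiext u f (_ :: _)).
rewrite equiext_tensor // big_cons mulgA; apply: IH => //.
exact: peel_multilinear.
Qed.

(** The shift v of the grading is there for the induction, where h is replaced by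
its partial applications. *)
Lemma contr_graded u v h l : multilinear h ->
  (forall l, graded_list gr l -> h (map snd l) \in gcomp gr (v * \prod_(p <- l) p.1)%g) ->
  graded_list gr l ->
  contr u h (map snd l) \in gcomp gr (v * u * \prod_(p <- l) p.1)%g.
Proof.
move=> mh gh hl; have hu : skew_unit u \in gcomp gr u by apply: skew_tensorP.
elim: l h u hu mh gh hl => [|[s b] l IH] h u hu mh gh hl.
  by have := gh [:: (u, skew_unit u)]; rewrite /= hu big_seq1 big_nil mulg1; apply.
have := gh [:: (u, skew_unit u), (s, b) & l].
rewrite [map snd _]/= [graded_list _ _]/= hu; move: hl => /= /andP[hb hl].
rewrite hb hl => /(_ isT); rewrite !big_cons !mulgA /=.
case/skew_compP: (hb) => a ->; rewrite -/(contr u h (_ :: _)) contr_tensor //.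
move=> hh; rewrite addrC -scaleN1r.
have [_] := gcomp_submod gr (v * u * s * \prod_(p <- l) p.1)%g; apply => //.
rewrite -[(v * u * s)%g]mulgA; apply: IH => //; first exact: skew_tensorP.
  exact: peel_multilinear.
move=> l' hl'; have := gh ((1%g, skew_const (rho u a)) :: l').
by rewrite /= hl' skew_tensorP big_cons mul1g; apply.
Qed.

(** [equiext], and [contr] below, only use the values on lists of a single length:
they preserve boundedness, and [equiext] commutes with taking homogeneous
components. *)
Lemma eq_equiext u f g l : (forall l', size l' = size l -> f l' = g l') ->
  equiext u f l = equiext u g l.
Proof.
elim: l u f g => [|b l IH] u f g fg /=; first by rewrite fg.
by apply: eq_bigr => s _; apply: IH => l' sl; rewrite /peel fg //= sl.
Qed.

Lemma eq_contr u h h' l : (forall l', size l' = (size l).+1 -> h l' = h' l') ->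
  contr u h l = contr u h' l.
Proof.
elim: l u h h' => [|b l IH] u h h' hh /=; first by rewrite hh.
rewrite hh //; congr (_ - _).
by apply: eq_bigr => s _; apply: IH => l' sl; rewrite /peel hh //= sl.
Qed.

Lemma equiext_multilinear u f : multilinear f -> multilinear (equiext u f).
Proof.
move=> mf a s; elim: s u f mf => [|b s IH] u f mf t x y; last first.
  rewrite /= scaler_sumr -big_split; apply: eq_bigr => v _ /=.
  by rewrite IH //; apply: peel_multilinear.
rewrite /= scaler_sumr -big_split; apply: eq_bigr => v _ /=.
by rewrite !ffunE linearP peel_lin // equiext_linear.
Qed.

Lemma contr_multilinear u h : multilinear h -> multilinear (contr u h).
Proof.
move=> mh a s; elim: s u h mh => [|b s IH] u h mh t x y.
  rewrite /= (mh a [:: skew_unit u]) scalerBr addrACA -opprD; congr (_ - _).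
  rewrite scaler_sumr -big_split; apply: eq_bigr => v _ /=.
  by rewrite !ffunE !linearP /= peel_lin // contr_linear.
rewrite /= (mh a [:: skew_unit u, b & s]) scalerBr addrACA -opprD; congr (_ - _).
rewrite scaler_sumr -big_split; apply: eq_bigr => v _ /=.
by rewrite IH //; apply: peel_multilinear.
Qed.

Lemma equiext_is_cochain u (f : cochain L) : equiext u f \in @is_cochain k B.
Proof.
have /is_cochainP[mf [N fN]] := cochainP f; apply/is_cochainP.
split; first exact: equiext_multilinear.
exists N => l leN; rewrite (@eq_equiext _ _ 0) ?linear0 // => l' sl.
by rewrite fN ?sl.
Qed.

Definition restr_fun (h : seq B -> B) : seq L -> L :=
  fun l => h (map skew_const l) 1%g.

Lemma restr_is_cochain (h : cochain B) : restr_fun h \in @is_cochain k L.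
Proof.
have /is_cochainP[mh [N hN]] := cochainP h; apply/is_cochainP; split.
  by move=> a s t x y; rewrite /restr_fun !map_cat /= linearP mh !ffunE.
by exists N => l leN; rewrite /restr_fun hN ?size_map // ffunE.
Qed.

Definition contr_avg (h : seq B -> B) : seq B -> B := fun l =>
  #|gT|%:R^-1 *: \sum_u skew_unit u^-1 * contr u h l.

Lemma contr_avg_is_cochain (h : cochain B) : contr_avg h \in @is_cochain k B.
Proof.
have /is_cochainP[mh [N hN]] := cochainP h; apply/is_cochainP; split.
  move=> a s t x y; rewrite /contr_avg scalerA mulrC -scalerA -scalerDr.
  congr (_ *: _); rewrite scaler_sumr -big_split; apply: eq_bigr => u _ /=.
  by rewrite contr_multilinear // mulrDr -scalerAr.
exists N => l leN; rewrite /contr_avg big1 ?scaler0 // => u _.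
rewrite (@eq_contr _ _ 0) ?linear0 ?mulr0 // => l' sl.
by rewrite hN ?sl // ltnW.
Qed.

(** * Restriction, extension, average and homotopy on cochains *)

Definition extend (f : cochain L) : cochain B := Cochain (equiext_is_cochain 1 f).
Definition restrict (h : cochain B) : cochain L := Cochain (restr_is_cochain h).
Definition homotopy (h : cochain B) : cochain B := Cochain (contr_avg_is_cochain h).
Definition average (f : cochain L) : cochain L :=
  #|gT|%:R^-1 *: \sum_s cochain_act rho s f.

Local Notation graded := (is_graded gr).

(** Evaluating at 1 loses nothing: on arguments from the component of 1, a graded
cochain takes its values in that component. *)
Lemma restrict_const (h : cochain B) l : h \in graded ->
  h (map skew_const l) = skew_const (restrict h l).
Proof.
move=> /is_gradedP/(_ [seq (1%g, skew_const a) | a <- l]).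
rewrite -map_comp (eq_map (g := skew_const)) // big_map big1 // => gh.
have /gh/skew_compP[a /= E] : graded_list gr [seq (1%g, skew_const a) | a <- l].
  by rewrite /graded_list all_map; apply/allP => a _; apply: skew_tensorP.
by rewrite /= /restr_fun E skew_constK.
Qed.

Lemma extend_linear : linear extend.
Proof. by move=> a f g; apply: val_inj; apply: (equiext_linear 1). Qed.
HB.instance Definition _ :=
  GRing.isLinear.Build k (cochain L) (cochain B) _ extend extend_linear.

Lemma restrict_linear : linear restrict.
Proof. by move=> a f g; apply/val_inj/funext => l; rewrite /= /restr_fun !ffunE. Qed.
HB.instance Definition _ :=
  GRing.isLinear.Build k (cochain B) (cochain L) _ restrict restrict_linear.

Lemma average_linear : linear average.
Proof.
move=> a f g; rewrite /average scalerA mulrC -scalerA -scalerDr; congr (_ *: _).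
by rewrite scaler_sumr -big_split; apply: eq_bigr => s _; rewrite linearP.
Qed.
HB.instance Definition _ :=
  GRing.isLinear.Build k (cochain L) (cochain L) _ average average_linear.

Lemma extendK : cancel extend restrict.
Proof.
move=> f; have /is_cochainP[mf _] := cochainP f.
by apply/val_inj/funext => l; rewrite /= /restr_fun equiext_const // skew_constK.
Qed.

Lemma restrictM (g h : cochain B) : g \in graded -> h \in graded ->
  restrict (g * h) = restrict g * restrict h.
Proof.
move=> gg gh; apply/val_inj/funext => l; rewrite /= /restr_fun.
rewrite (cup_map (i := skew_const) (f := restrict g) (f' := restrict h)) ?skew_constK //.
  by move=> t; rewrite restrict_const.
by move=> t; rewrite restrict_const.
Qed.

Lemma restrict1 : restrict 1 = 1.
Proof.
by apply/val_inj/funext => -[|a l]; rewrite /= /restr_fun /= ffunE ?eqxx.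
Qed.

Lemma restrict_diff (h : cochain B) : h \in graded -> restrict (diff h) = diff (restrict h).
Proof.
move=> gh; apply/val_inj/funext => l; rewrite /= /restr_fun.
rewrite (hdiff_map (i := skew_const) (f := restrict h)) ?skew_constK // => t.
by rewrite restrict_const.
Qed.

Lemma restrict_component n (h : cochain B) : restrict (component n h) = component n (restrict h).
Proof.
apply/val_inj/funext => l; rewrite /= /restr_fun /= /hcomp size_map.
by case: eqP => // _; rewrite ffunE.
Qed.

Lemma extend_component n (f : cochain L) : extend (component n f) = component n (extend f).
Proof.
apply/val_inj/funext => l; rewrite /= /hcomp.
case: eqP => E.
  by apply: eq_equiext => l' sl; rewrite sl E eqxx.
rewrite (@eq_equiext _ _ 0) ?linear0 // => l' sl.
by rewrite sl; case: eqP.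
Qed.

Lemma averageE (f : cochain L) l :
  average f l = #|gT|%:R^-1 *: \sum_s fun_act rho s f l.
Proof.
rewrite /average -[LHS]/(_ *: cochain_fun (\sum_s cochain_act rho s f) l).
by rewrite cochain_sumE.
Qed.

Lemma average_component n (f : cochain L) : average (component n f) = component n (average f).
Proof.
apply/val_inj/funext => l.
rewrite [LHS]averageE -[RHS]/(hcomp n (average f) l) /hcomp averageE; case: eqP => E; last first.
  rewrite big1 ?scaler0 // => s _.
  by rewrite /fun_act /= /hcomp size_map; case: eqP => // _; rewrite linear0.
congr (_ *: _); apply: eq_bigr => s _.
by rewrite /fun_act /= /hcomp size_map E eqxx.
Qed.

Lemma average_diff (f : cochain L) : average (diff f) = diff (average f).
Proof.
rewrite /average linearZ; congr (_ *: _); rewrite [RHS]linear_sum.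
by apply: eq_bigr => s _; rewrite /= diff_act.
Qed.

(** * The homotopy formula *)

Hypothesis hG : (#|gT|%:R : k) \is a GRing.unit.

Lemma average_scale_sum (V : lmodType k) (F : gT -> V) (x : V) :
  (forall s, F s = x) -> #|gT|%:R^-1 *: \sum_s F s = x.
Proof.
move=> Fx; under eq_bigr do rewrite Fx.
by rewrite sumr_const -(scaler_nat #|gT|) scalerA mulVr // scale1r.
Qed.

Lemma cochain_act_average s (f : cochain L) : cochain_act rho s (average f) = average f.
Proof.
rewrite /average linearZ; congr (_ *: _).
rewrite [LHS]linear_sum [RHS](reindex_inj (mulgI s)) /=.
by apply: eq_bigr => t _; rewrite /= -cochain_actM.
Qed.

Lemma average_id (f : cochain L) :
  (forall s, cochain_act rho s f = f) -> average f = f.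
Proof. exact: average_scale_sum. Qed.

Lemma extend_graded (f : cochain L) : extend f \in graded.
Proof.
have /is_cochainP[mf _] := cochainP f.
by apply/is_gradedP => l hl; rewrite -[X in gcomp _ X]mul1g equiext_graded.
Qed.

Lemma homotopy_graded (h : cochain B) : h \in graded -> homotopy h \in graded.
Proof.
have /is_cochainP[mh _] := cochainP h.
move=> /is_gradedP gh; apply/is_gradedP => l hl.
have [c0 cL] := gcomp_submod gr (\prod_(p <- l) p.1)%g.
rewrite -[X in X \in _]addr0; apply: (cL) => //.
elim/big_rec: _ => // u x _ hx; rewrite -[_ * _]scale1r; apply: (cL) => //.
rewrite -[X in gcomp _ X](mulKg u); apply: gcompM; first exact: skew_tensorP.
have := @contr_graded u 1%g h l mh; rewrite mul1g; apply=> // l' hl'.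
by rewrite mul1g gh.
Qed.

(** The leftmost face. Multiplying the inserted U u with the U u^-1 in front gives
the identity. In the other terms, with b of degree s, the product U u^-1 * c_1
equals b * U (u s)^-1, so they add up to minus b times the mean over u s in
place of u; this is the same mean. *)
Lemma homotopy_idc (h : cochain B) l : multilinear h ->
  cup (@idc k B) (homotopy h) l
    + #|gT|%:R^-1 *: (\sum_u skew_unit u^-1 * contr u (cup (@idc k B) h) l) = h l.
Proof.
move=> mh; case: l => [|b l].
  rewrite cup_nil mul0r add0r; apply: average_scale_sum => u.
  by rewrite /= idc_cup mulrA skew_unitVM mul1r.
rewrite idc_cup -[homotopy h l]/(#|gT|%:R^-1 *: _) -scalerAr -scalerDr.
rewrite -[RHS](@average_scale_sum _ (fun=> h (b :: l))) //; congr (_ *: _).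
have -> : b * (\sum_u skew_unit u^-1 * contr u h l) = \sum_u \sum_s
    skew_unit u^-1 * (skew_const (rho u (b s)) * contr (u * s)%g h l).
  rewrite {1}[b]skew_sum mulr_suml exchange_big; apply: eq_bigr => s _ /=.
  rewrite mulr_sumr (reindex_inj (mulIg s)); apply: eq_bigr => u _.
  rewrite !mulrA; congr (_ * _).
  rewrite skew_unit_tensor mulg1 aautK skew_mulTE rmorph1 mulr1.
  by rewrite invMg mulKVg.
rewrite -big_split; apply: eq_bigr => u _ /=.
rewrite idc_cup mulrBr mulrA skew_unitVM mul1r addrC mulr_sumr -addrA -[RHS]addr0.
congr (_ + _); apply/eqP; rewrite addrC subr_eq0; apply/eqP; apply: eq_bigr => s _.
congr (_ * _); rewrite -contr_mull; congr (contr _ _ _).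
by apply/funext => t; rewrite /peel idc_cup.
Qed.

Lemma homotopyP (h : cochain B) : h \in graded ->
  diff (homotopy h) + homotopy (diff h) = h - extend (average (restrict h)).
Proof.
move=> gh; have /is_cochainP[mh _] := cochainP h.
pose c := #|gT|%:R^-1 : k.
have hR u l : contr u (rdiff h) l + rdiff (contr u h) l = - equiext u (restrict h) l.
  by apply: contr_rdiff => // t; rewrite restrict_const.
have homE : (homotopy h : seq B -> B) =
    c *: \sum_u (fun l => skew_unit u^-1 * contr u h l).
  by apply/funext => l; rewrite fctZ fct_sumE.
have extE l : extend (average (restrict h)) l =
    c *: \sum_u skew_unit u^-1 * equiext u (restrict h) l.
  rewrite /average linearZ -[LHS]/(_ *: cochain_fun _ l); congr (_ *: _).
  rewrite linear_sum cochain_sumE.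
  rewrite (reindex_inj invg_inj) /=; apply: eq_bigr => u _.
  by rewrite equiext_unit mulVg.
have rdiffE l : rdiff (homotopy h) l = c *: \sum_u skew_unit u^-1 * rdiff (contr u h) l.
  rewrite homE [rdiff _]linearZ raddf_sum -[LHS]/(c *: _ l) fct_sumE; congr (_ *: _).
  by apply: eq_bigr => u _; apply: rdiff_mull.
have homdE l : homotopy (diff h) l =
    c *: (\sum_u skew_unit u^-1 * contr u (cup (@idc k B) h) l)
    + c *: \sum_u skew_unit u^-1 * contr u (rdiff h) l.
  rewrite /= /contr_avg -scalerDr -big_split; congr (_ *: _).
  by apply: eq_bigr => u _; rewrite /= hdiff_rdiff linearD fctD mulrDr.
apply/val_inj/funext => l.
rewrite -[LHS]/(hdiff (homotopy h) l + homotopy (diff h) l).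
rewrite -[RHS]/(h l - extend (average (restrict h)) l).
rewrite hdiff_rdiff fctD rdiffE homdE extE.
rewrite addrACA (homotopy_idc _ mh); congr (_ + _).
rewrite -scalerDr -big_split -scalerN -sumrN; congr (_ *: _).
by apply: eq_bigr => u _; rewrite /= addrC -mulrDr hR mulrN.
Qed.

Lemma homotopy0 : homotopy 0 = 0.
Proof.
apply/val_inj/funext => l; rewrite -[LHS]/(_ *: _) big1 ?scaler0 // => u _.
by rewrite [contr _ _]linear0 mulr0.
Qed.

(** No computation is needed: applying diff to [homotopyP] shows that
[extend \o average \o restrict] commutes with diff on graded cochains, and on
the graded cochain [extend f] this composite is [extend f] again. *)
Lemma diff_extend (f : cochain L) : (forall s, cochain_act rho s f = f) ->
  diff (extend f) = extend (diff f).
Proof.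
move=> inv; have ge := extend_graded f.
have := homotopyP (is_graded_diff ge).
rewrite diff_diff homotopy0 addr0 restrict_diff // extendK average_diff average_id //.
have /(congr1 (@diff k B)) := homotopyP ge.
rewrite linearD linearB /= diff_diff add0r extendK average_id // => -> /addrI.
by move=> /oppr_inj.
Qed.

(** * The isomorphism in cohomology *)

Local Notation S := (graded_subdga gr).
Local Notation F := (full_subdga L).

Lemma graded_cocycle (z : cocycle S) : (z : cochain B) \in graded /\ diff z = 0.
Proof. by have /andP[gz /eqP dz] := cocycleP z. Qed.

Lemma restrict_is_cocycle (z : cocycle S) : restrict z \in is_cocycle F.
Proof.
have [gz dz] := graded_cocycle z.
by apply/andP; split; rewrite // -restrict_diff // dz linear0.
Qed.
Definition restrict_cocycle (z : cocycle S) : cocycle F := Cocycle (restrict_is_cocycle z).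

Lemma average_is_cocycle (z : cocycle F) : average z \in is_cocycle F.
Proof.
have /andP[_ /eqP dz] := cocycleP z.
by apply/andP; split; rewrite // -average_diff dz linear0.
Qed.
Definition average_cocycle (z : cocycle F) : cocycle F := Cocycle (average_is_cocycle z).

Lemma extend_is_cocycle (z : cocycle F) : extend (average z) \in is_cocycle S.
Proof.
have /andP[_ /eqP dz] := cocycleP (average_cocycle z).
apply/andP; split; first exact: extend_graded.
rewrite diff_extend ?dz ?linear0 // => s; apply: cochain_act_average.
Qed.
Definition extend_cocycle (z : cocycle F) : cocycle S := Cocycle (extend_is_cocycle z).

Lemma restrict_extend_cocycle z : restrict_cocycle (extend_cocycle z) = average_cocycle z.
Proof. by apply/val_inj/extendK. Qed.

Definition restrict_coh (x : HH_id gr) : HH L := coh_class (restrict_cocycle (coh_repr x)).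

Lemma restrict_cohE z : restrict_coh (coh_class z) = coh_class (restrict_cocycle z).
Proof.
apply/eqP; rewrite coh_classE.
have /is_boundaryP[w gw dw] := coh_reprB z.
apply/is_boundaryP; exists (restrict w) => //.
by rewrite -restrict_diff // dw -[LHS]/(restrict (_ - _)) linearB.
Qed.

Lemma restrict_coh_linear : linear restrict_coh.
Proof.
move=> a x y; rewrite -[x]coh_reprK -[y]coh_reprK -linearP !restrict_cohE -linearP.
by congr coh_class; apply: val_inj; rewrite /= [LHS]linearP.
Qed.
HB.instance Definition _ :=
  GRing.isLinear.Build k (HH_id gr) (HH L) _ restrict_coh restrict_coh_linear.

Lemma restrict_coh_monoid : monoid_morphism restrict_coh.
Proof.
split=> [|x y].
  rewrite -[LHS]/(restrict_coh (coh_class 1)) restrict_cohE -[RHS]/(coh_class 1).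
  congr coh_class; by apply: val_inj; apply: restrict1.
rewrite -[x]coh_reprK -[y]coh_reprK -rmorphM !restrict_cohE -rmorphM.
congr coh_class; apply: val_inj; apply: restrictM.
  by case: (graded_cocycle (coh_repr x)).
by case: (graded_cocycle (coh_repr y)).
Qed.
HB.instance Definition _ :=
  GRing.isMonoidMorphism.Build (HH_id gr) (HH L) restrict_coh restrict_coh_monoid.

(** Restricting the homotopy formula to L. *)
Lemma coh_class_restrict_average z :
  coh_class (average_cocycle (restrict_cocycle z)) = coh_class (restrict_cocycle z).
Proof.
have [gz dz] := graded_cocycle z; apply/esym/eqP; rewrite coh_classE.
apply/is_boundaryP; exists (restrict (homotopy z)) => //.
have := homotopyP gz; rewrite dz homotopy0 addr0 => hz.
by rewrite -restrict_diff ?homotopy_graded // hz linearB /= extendK.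
Qed.

Lemma restrict_coh_invariant x : restrict_coh x \in is_invariant rho.
Proof.
rewrite -[x]coh_reprK restrict_cohE -coh_class_restrict_average.
apply/forallP => s; rewrite HH_actE; apply/eqP; congr coh_class.
exact/val_inj/cochain_act_average.
Qed.

(** The class of the average is the mean of the translates of the class. *)
Lemma coh_class_average z : coh_class z \in is_invariant rho ->
  coh_class (average_cocycle z) = coh_class z.
Proof.
move=> /forallP inv; rewrite -[RHS](@average_scale_sum _ (fun s => HH_act rho s (coh_class z))).
  transitivity (coh_class (#|gT|%:R^-1 *: \sum_s cocycle_act rho s z)).
    congr coh_class; apply: val_inj; congr (_ *: _).
    by rewrite (raddf_sum (val : cocycle F -> _)).
  rewrite linearZ linear_sum; congr (_ *: _); apply: eq_bigr => s _.
  by rewrite HH_actE.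
by move=> s; apply/eqP.
Qed.

(** If the restriction of z is diff w, then z is the differential of
[homotopy z + extend (average w)] by the homotopy formula. *)
Lemma restrict_coh_inj : injective restrict_coh.
Proof.
apply: raddf_inj => x; rewrite -[x]coh_reprK /= restrict_cohE.
set z := coh_repr x; have [gz dz] := graded_cocycle z.
move=> /coh_class_eq0/is_boundaryP[w _ dw]; apply/coh_class_eq0/is_boundaryP.
exists (homotopy z + extend (average w)).
  have [_ cL _] := is_graded_subalg gr.
  by rewrite -[homotopy z]scale1r cL ?homotopy_graded ?extend_graded.
have := homotopyP gz; rewrite dz homotopy0 addr0 => hz.
rewrite linearD /= hz diff_extend; last by move=> s; exact: cochain_act_average.
by rewrite -average_diff dw subrK.
Qed.

Definition restrict_inv (x : HH_id gr) : HHinv rho := HHInv (restrict_coh_invariant x).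
Definition extend_inv (y : HHinv rho) : HH_id gr :=
  coh_class (extend_cocycle (coh_repr (HHinv_val y))).

Lemma restrict_inv_linear : linear restrict_inv.
Proof. by move=> a x y; apply: val_inj; rewrite /= linearP. Qed.
HB.instance Definition _ :=
  GRing.isLinear.Build k (HH_id gr) (HHinv rho) _ restrict_inv restrict_inv_linear.
Lemma restrict_inv_monoid : monoid_morphism restrict_inv.
Proof.
split=> [|x y]; apply: val_inj; first by rewrite /= rmorph1.
by rewrite /= [LHS]rmorphM.
Qed.
HB.instance Definition _ :=
  GRing.isMonoidMorphism.Build (HH_id gr) (HHinv rho) restrict_inv restrict_inv_monoid.

Lemma restrict_coh_extend z : coh_class z \in is_invariant rho ->
  restrict_coh (coh_class (extend_cocycle z)) = coh_class z.
Proof.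
by move=> inv; rewrite restrict_cohE restrict_extend_cocycle coh_class_average.
Qed.

Lemma extend_invK : cancel extend_inv restrict_inv.
Proof.
move=> [y inv]; apply: val_inj; by rewrite /= restrict_coh_extend coh_reprK.
Qed.

Lemma restrict_inv_inj : injective restrict_inv.
Proof. by move=> x y /(congr1 (@HHinv_val _ _ _ rho)) /restrict_coh_inj. Qed.

(** The preimage of the class of a homogeneous cocycle z is the class of
[extend (average z)], which is again homogeneous. *)
Lemma coh_degree_restrict n x : coh_degree n x <-> coh_degree n (restrict_coh x).
Proof.
split=> [[z hz <-]|[z hz Ez]].
  exists (restrict_cocycle z); last by rewrite restrict_cohE.
  by rewrite /homogeneous /= -restrict_component hz.
exists (extend_cocycle z).
  by rewrite /homogeneous /= -extend_component -average_component hz.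
apply: restrict_coh_inj; rewrite restrict_coh_extend // Ez.
exact: restrict_coh_invariant.
Qed.

End Skew.

Theorem theorem5p1 (k : fieldType) (gT : finGroupType)
    (hG : (#|gT|%:R : k) \is a GRing.unit)
    (L : algType k) (rho : alg_action gT L) :
  exists f : {lrmorphism HH_id (skew_grading rho) -> HHinv rho},
    bijective f /\
    forall (n : nat) (x : HH_id (skew_grading rho)),
      coh_degree n x <-> coh_degree n (HHinv_val (f x)).
Proof.
exists (@restrict_inv k gT L rho hG); split; last first.
  by move=> n x; apply: coh_degree_restrict.
exists (extend_inv hG); last exact: extend_invK.
by apply: inj_can_sym; [exact: extend_invK | exact: restrict_inv_inj].
Qed.
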